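(* Let $k$ be an algebraically closed field and $X\subset\mathbb P_k^{n-1}$ a simplicial projective toric variety with exactly one singular point. Then $X$ is an ideal-theoretic complete intersection if and only if either (i) $X$ is the monomial curve in $\mathbb P_k^{n-1}$, $n\ge3$, of degree $d\ge3$ defined parametrically by $x_1=t_1^d,\ x_2=t_2^d,\ x_3=t_1^{d-1}t_2,\ x_4=t_1^{d-d_4}t_2^{d_4},\ldots,x_n=t_1^{d-d_n}t_2^{d_n}$, where $1<d_4<\cdots<d_n<d$ and $d_4\mid d_5\mid\cdots\mid d_n\mid d$; or (ii) $X$ is the surface in $\mathbb P_k^3$ of degree $2$ defined parametrically by $x_1=t_1^2,\ x_2=t_2^2,\ x_3=t_3^2,\ x_4=t_1t_2$.
   Context: $e_1,\ldots,e_m$ is the canonical basis of $\mathbb Z^m$. For distinct nonzero $a_1,\ldots,a_n\in\mathbb N^m$, $I_{\mathcal A}\subset k[x_1,\ldots,x_n]$ is the kernel of $x_i\mapsto t^{a_i}=t_1^{a_{i1}}\cdots t_m^{a_{im}}$. A simplicial projective toric variety is $V(I_{\mathcal A})\subset\mathbb P^{n-1}_k$ where $n>m$, $a_l=de_l$ ($1\le l\le m$) for some $d\in\mathbb Z^+$, and each $a_i$, $i>m$, has coordinate sum $d$. A variety is an ideal-theoretic complete intersection if its defining ideal $I_{\mathcal A}$ is minimally generated by as many elements as its height $n-m$. The variety given parametrically by monomials $x_l=t^{b_l}$ is $V(I_{\{b_l\}})$ (up to permuting coordinates). *)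

(* Defs.v *)
From HB Require Import structures.
From mathcomp Require Import all_boot all_order all_algebra all_fingroup.
Set Implicit Arguments. Unset Strict Implicit. Unset Printing Implicit Defensive.
Import Order.TTheory GRing.Theory Num.Theory.
Local Open Scope ring_scope.

(* Polynomials in k[x_0,...,x_{n-1}] represented as formal finite sums of
   terms (coefficient, exponent vector).  Two representations denote the same
   polynomial iff they have the same coefficient function [pcoef]. *)
Definition mono (n : nat) := {ffun 'I_n -> nat}.
Definition mpol (k : fieldType) (n : nat) := seq (k * mono n).

Definition pcoef (k : fieldType) n (p : mpol k n) (al : mono n) : k :=
  \sum_(t <- p | t.2 == al) t.1.

Definition peq (k : fieldType) n (p q : mpol k n) : Prop :=
  forall al, pcoef p al = pcoef q al.

Definition pmul (k : fieldType) n (p q : mpol k n) : mpol k n :=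
  [seq ((s.1 * t.1)%R, [ffun i => (s.2 i + t.2 i)%N] : mono n) | s : k * mono n <- p, t : k * mono n <- q].

Definition lincomb (k : fieldType) n r (h g : 'I_r -> mpol k n) : mpol k n :=
  flatten [seq pmul (h j) (g j) | j <- enum 'I_r].

Definition peval (k : fieldType) n (p : mpol k n) (x : 'I_n -> k) : k :=
  \sum_(t <- p) t.1 * \prod_(i < n) x i ^+ t.2 i.

Definition pderiv (k : fieldType) n (p : mpol k n) (i : 'I_n) : mpol k n :=
  [seq (t.1 *+ t.2 i, [ffun j => if j == i then (t.2 j).-1 else t.2 j] : mono n) | t : k * mono n <- p].

(* exponent of t in the image of the monomial x^al under x_i |-> t^{a_i} *)
Definition imexp m n (a : 'I_n -> 'I_m -> nat) (al : mono n) : mono m :=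
  [ffun j => (\sum_(i < n) al i * a i j)%N].

(* f belongs to the toric ideal I_A = ker (x_i |-> t^{a_i}): every coefficient
   of the image polynomial in k[t_1..t_m] vanishes. *)
Definition inIA (k : fieldType) m n (a : 'I_n -> 'I_m -> nat) (f : mpol k n) : Prop :=
  forall mu : mono m, \sum_(t <- f | imexp a t.2 == mu) t.1 = 0.

(* affine cone over V(I_A) *)
Definition inV (k : fieldType) m n (a : 'I_n -> 'I_m -> nat) (x : 'I_n -> k) : Prop :=
  forall f : mpol k n, inIA a f -> peval f x = 0.

Definition simplicial_data m n (d : nat) (a : 'I_n -> 'I_m -> nat) : Prop :=
  [/\ (m < n)%N /\ (0 < d)%N, injective a,
      (forall i, exists j, a i j <> 0%N),
      (forall (i : 'I_n) (j : 'I_m), (i < m)%N -> a i j = (if val j == val i then d else 0)%N)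
    & (forall i : 'I_n, (m <= i)%N -> (\sum_(j < m) a i j)%N = d)].

(* I_A is generated by n - m elements (its height) *)
Definition ideal_ci (k : fieldType) m n (a : 'I_n -> 'I_m -> nat) : Prop :=
  exists g : 'I_(n - m) -> mpol k n,
    forall f, inIA a f <-> exists h : 'I_(n - m) -> mpol k n, peq f (lincomb h g).

(* Jacobian criterion: a nonzero point x of the affine cone is a singular point
   of X iff the gradients at x of the elements of I_A span a space of
   dimension < n - m = height I_A = codim X. *)
Definition singular_pt (k : fieldType) m n (a : 'I_n -> 'I_m -> nat) (x : 'I_n -> k) : Prop :=
  [/\ inV a x, x <> (fun _ => 0)
    & ~ exists f : 'I_(n - m) -> mpol k n,
          (forall l, inIA a (f l)) /\
          \rank (\matrix_(l < n - m, j < n) peval (pderiv (f l) j) x) = (n - m)%N].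

Definition one_singular_point (k : fieldType) m n (a : 'I_n -> 'I_m -> nat) : Prop :=
  exists p : 'I_n -> k, singular_pt a p /\
    forall q, singular_pt a q -> exists c : k, q = (fun i => c * p i).

Definition same_up_to_perm (k : fieldType) m m' n
  (a : 'I_n -> 'I_m -> nat) (b : 'I_n -> 'I_m' -> nat) : Prop :=
  exists s : {perm 'I_n}, forall x : 'I_n -> k, inV a x <-> inV b (fun l => x (s l)).

(* case (i): x_1=t1^d, x_2=t2^d, x_3=t1^{d-1}t2, x_l = t1^{d-d_l} t2^{d_l};
   0-indexed: index i >= 3 carries exponent dd i (= d_{i+1}). *)
Definition curveB n (d : nat) (dd : nat -> nat) : 'I_n -> 'I_2 -> nat :=
  fun i j =>
    let e := (if val i == 0%N then 0 else if val i == 1%N then d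
              else if val i == 2%N then 1 else dd (val i))%N in
    if val j == 0%N then (d - e)%N else e.

Definition curve_cond n (d : nat) (dd : nat -> nat) : Prop :=
  let ddx i := (if (i < n)%N then dd i else d) in
  [/\ (3 <= n)%N, (3 <= d)%N &
      forall i, (3 <= i < n)%N ->
        [/\ (1 < dd i)%N, (dd i < ddx i.+1)%N & (dd i %| ddx i.+1)%N]].

Definition surfB n : 'I_n -> 'I_3 -> nat :=
  fun i j => if (val i < 3)%N then (if val j == val i then 2 else 0)%N
             else (if (val j < 2)%N then 1 else 0)%N.

(* Main.v *)
Require Import Defs.
From HB Require Import structures.
From mathcomp Require Import all_boot all_order all_algebra all_fingroup.
From mathcomp Require Import boolp.
From mathcomp Require Import zify.
Set Implicit Arguments. Unset Strict Implicit. Unset Printing Implicit Defensive.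
Import Order.TTheory GRing.Theory Num.Theory.
Local Open Scope ring_scope.

(** A monomial is isolated when no other monomial of its toric degree shares a
    variable with it.  The coefficient of an isolated monomial in [sum_j h_j g_j]
    only involves the constant terms of the [h_j]; hence a toric ideal generated
    by [r] elements admits at most [r] isolated monomials each having the degree
    of some monomial outside the family.

    If the vertex [P] is smooth, the Jacobian criterion gives [n - m] isolated
    monomials [x_j x_P^N] of pairwise distinct degrees, so that for a complete
    intersection every isolated monomial has one of these degrees and no degree
    has three of them.  Each non-vertex [q] contributes one more, the least power
    [x_q^c] that is not alone in its degree.  When [m >= 3] two smooth vertices
    [P, P'] are available, and comparing both families forces
    [2 a_q = a_P + a_P'] for all [q], which is case (ii).  When [m = 2] the degree
    of [x_q^c] is that of some [x_j x_P^N], so that [c e_q = e_j] for the positions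
    [e] along the line; [q |-> j] is injective and increasing, hence the successor
    map, which is the divisibility chain of case (i).

    Conversely the variety determines the kernel of the degree map, and in both
    cases pure power relations rewrite monomials to normal forms that are
    determined by their degree. *)

(** * Polynomials as linear functionals and toric ideals *)

Definition mX n (i : 'I_n) (N : nat) : mono n := [ffun j => if j == i then N else 0%N].
Definition madd n (al be : mono n) : mono n := [ffun i => (al i + be i)%N].
Definition msub n (al be : mono n) : mono n := [ffun i => (al i - be i)%N].

Lemma maddC n (al be : mono n) : madd al be = madd be al.
Proof. by apply/ffunP => i; rewrite !ffunE addnC. Qed.

Lemma maddIl n (al be ga : mono n) : madd al be = madd al ga -> be = ga.
Proof.
by move=> /ffunP e; apply/ffunP => i; move: (e i); rewrite !ffunE => /addnI.
Qed.

Lemma msubK n (al be : mono n) :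
  (forall i, be i <= al i)%N -> madd be (msub al be) = al.
Proof. by move=> le; apply/ffunP => i; rewrite !ffunE subnKC. Qed.

Definition tdeg n (al : mono n) := (\sum_i al i)%N.

Lemma tdeg_madd n (al be : mono n) : tdeg (madd al be) = (tdeg al + tdeg be)%N.
Proof. by rewrite /tdeg -big_split; apply: eq_bigr => i _; rewrite ffunE. Qed.

Lemma tdeg_mX n (i : 'I_n) N : tdeg (mX i N) = N.
Proof.
rewrite /tdeg (bigD1 i) //= big1 ?ffunE ?eqxx ?addn0 // => j /negPf ne.
by rewrite ffunE ne.
Qed.

Lemma imexp_madd m n (a : 'I_n -> 'I_m -> nat) al be :
  imexp a (madd al be) = madd (imexp a al) (imexp a be).
Proof.
apply/ffunP => j; rewrite !ffunE -big_split; apply: eq_bigr => i _.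
by rewrite ffunE mulnDl.
Qed.

Lemma imexp_mX m n (a : 'I_n -> 'I_m -> nat) i N j :
  imexp a (mX i N) j = (N * a i j)%N.
Proof.
rewrite ffunE (bigD1 i) //= big1 ?ffunE ?eqxx ?addn0 // => l /negPf ne.
by rewrite ffunE ne.
Qed.

Section Functionals.
Variables (k : fieldType) (n : nat).
Implicit Types (f g p q : mpol k n) (c : mono n -> k).

(* The linear functional sending x^al to [c al]; two representations are
   [peq] exactly when no such functional separates them. *)
Definition psum f c := \sum_(t <- f) t.1 * c t.2.

Lemma pcoefE f al : pcoef f al = psum f (fun be => (be == al)%:R).
Proof.
rewrite /pcoef /psum big_mkcond; apply: eq_bigr => t _.
by case: eqP; rewrite ?mulr1 ?mulr0.
Qed.

Lemma psum_supp f c (S : seq (mono n)) : uniq S -> {subset [seq t.2 | t <- f] <= S} ->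
  psum f c = \sum_(al <- S) pcoef f al * c al.
Proof.
move=> uS; rewrite /psum /pcoef; elim: f => [|t f IH] sub.
  by rewrite big_nil big1_seq // => al _; rewrite big_nil mul0r.
rewrite big_cons IH; last by move=> x xf; apply: sub; rewrite inE xf orbT.
rewrite (bigD1_seq t.2) //=; last by apply: sub; rewrite inE eqxx.
rewrite [RHS](bigD1_seq t.2) //=; last by apply: sub; rewrite inE eqxx.
rewrite addrA big_cons eqxx mulrDl; congr (_ + _).
by apply: eq_bigr => al /negPf ne; rewrite big_cons eq_sym ne.
Qed.

Lemma psum_peq f g : peq f g -> forall c, psum f c = psum g c.
Proof.
move=> fg c; pose S := undup ([seq t.2 | t <- f] ++ [seq t.2 | t <- g]).
rewrite (@psum_supp f c S) ?undup_uniq //; last first.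
  by move=> x xf; rewrite mem_undup mem_cat xf.
rewrite (@psum_supp g c S) ?undup_uniq //; last first.
  by move=> x xf; rewrite mem_undup mem_cat xf orbT.
by apply: eq_bigr => al _; rewrite fg.
Qed.

Lemma peq_psum f g : (forall c, psum f c = psum g c) -> peq f g.
Proof. by move=> fg al; rewrite !pcoefE fg. Qed.

Lemma psum_cat f g c : psum (f ++ g) c = psum f c + psum g c.
Proof. by rewrite /psum big_cat. Qed.

Lemma eq_psum f c c' : (forall al, c al = c' al) -> psum f c = psum f c'.
Proof. by move=> cc'; apply: eq_bigr => t _; rewrite cc'. Qed.

Lemma psum_pmul p q c :
  psum (pmul p q) c = \sum_(s <- p) s.1 * psum q (fun be => c (madd s.2 be)).
Proof.
rewrite /psum /pmul big_allpairs_dep; apply: eq_bigr => s _.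
by rewrite mulr_sumr; apply: eq_bigr => t _; rewrite mulrA.
Qed.

Lemma psum_lincomb r (h g : 'I_r -> mpol k n) c :
  psum (lincomb h g) c = \sum_j psum (pmul (h j) (g j)) c.
Proof.
by rewrite /psum /lincomb big_flatten big_map -big_enum.
Qed.

Definition bin (al be : mono n) : mpol k n := [:: (1, al); (-1, be)].

Lemma psum_bin al be c : psum (bin al be) c = c al - c be.
Proof. by rewrite /psum !big_cons big_nil addr0 mul1r mulN1r. Qed.

Definition mev (x : 'I_n -> k) (al : mono n) := \prod_i x i ^+ al i.

Lemma pevalE f x : peval f x = psum f (mev x).
Proof. by []. Qed.

Lemma mev_madd x al be : mev x (madd al be) = mev x al * mev x be.
Proof.
by rewrite /mev -big_split; apply: eq_bigr => i _; rewrite ffunE exprD.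
Qed.

Lemma mev_mX x i N : mev x (mX i N) = x i ^+ N.
Proof.
rewrite /mev (bigD1 i) //= big1 ?mulr1 ?ffunE ?eqxx // => j /negPf ne.
by rewrite ffunE ne.
Qed.

Lemma peval_pderiv f i x :
  peval (pderiv f i) x =
  psum f (fun al => (al i)%:R * mev x (msub al (mX i 1))).
Proof.
rewrite /peval /psum /pderiv big_map; apply: eq_bigr => t _ /=.
rewrite mulrA mulr_natr; congr (_ * _); apply: eq_bigr => j _; rewrite !ffunE.
by case: (j == i); rewrite ?subn1 ?subn0.
Qed.

Section Toric.
Variables (m : nat) (a : 'I_n -> 'I_m -> nat).


(** A functional constant on the fibres of the degree map factors through the image of [f] in the
    polynomial ring in the [t_j], all of whose coefficients vanish. *)
Lemma inIA_psum f : inIA a f -> forall c,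
  (forall al be, imexp a al = imexp a be -> c al = c be) -> psum f c = 0.
Proof.
move=> fI c cc; pose S := undup [seq imexp a t.2 | t <- f].
transitivity (\sum_(t <- f) \sum_(mu <- S | imexp a t.2 == mu) t.1 * c t.2).
  rewrite /psum !big_seq; apply: eq_bigr => t tf.
  rewrite (big_rem (imexp a t.2)) /=; last by rewrite mem_undup (map_f (fun t => imexp a t.2)).
  rewrite eqxx big_seq_cond big1 ?addr0 // => mu /andP[].
  by rewrite rem_filter ?undup_uniq // mem_filter eq_sym => /andP[/= /negPf ->].
rewrite (exchange_big_dep xpredT) //= big_seq big1 // => mu.
rewrite mem_undup => /mapP[t0 _ ->].
rewrite (eq_bigr (fun t => t.1 * c t0.2)); last by move=> t /eqP /cc ->.
by rewrite -mulr_suml fI mul0r.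
Qed.

Lemma psum_inIA f : (forall c,
  (forall al be, imexp a al = imexp a be -> c al = c be) -> psum f c = 0) -> inIA a f.
Proof.
move=> H mu; rewrite big_mkcond -[RHS](H (fun al => (imexp a al == mu)%:R)).
  by apply: eq_bigr => t _; case: ifP; rewrite ?mulr1 ?mulr0.
by move=> al be ->.
Qed.

Lemma inIA_bin al be : imexp a al = imexp a be -> inIA a (bin al be).
Proof. by move=> e; apply: psum_inIA => c cc; rewrite psum_bin (cc _ _ e) subrr. Qed.

Lemma inIA_pmul p q : inIA a q -> inIA a (pmul p q).
Proof.
move=> qI; apply: psum_inIA => c cc; rewrite psum_pmul big1 // => s _.
rewrite (inIA_psum qI) ?mulr0 // => al be e; apply: cc.
by rewrite !imexp_madd e.
Qed.

Lemma inIA_peq p q : peq p q -> inIA a q -> inIA a p.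
Proof.
move=> pq qI; apply: psum_inIA => c cc.
by rewrite (psum_peq pq) (inIA_psum qI).
Qed.

Lemma inIA_lincomb r (h g : 'I_r -> mpol k n) :
  (forall j, inIA a (g j)) -> inIA a (lincomb h g).
Proof.
move=> gI; apply: psum_inIA => c cc; rewrite psum_lincomb big1 // => j _.
exact: (inIA_psum (inIA_pmul _ (gI j))).
Qed.

Definition inG r (g : 'I_r -> mpol k n) f := exists h, peq f (lincomb h g).

Lemma inGP r (g : 'I_r -> mpol k n) f : inG g f <->
  exists h : 'I_r -> mpol k n, forall c, psum f c = \sum_j psum (pmul (h j) (g j)) c.
Proof.
split=> -[h H]; exists h.
  by move=> c; rewrite (psum_peq H) psum_lincomb.
by apply: peq_psum => c; rewrite H psum_lincomb.
Qed.

Lemma inG_cat r (g : 'I_r -> mpol k n) f f' : inG g f -> inG g f' -> inG g (f ++ f').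
Proof.
move=> /inGP[h H] /inGP[h' H']; apply/inGP; exists (fun j => h j ++ h' j) => c.
rewrite psum_cat H H' -big_split; apply: eq_bigr => j _.
by rewrite !psum_pmul big_cat.
Qed.

Lemma inG_nil r (g : 'I_r -> mpol k n) : inG g [::].
Proof.
apply/inGP; exists (fun=> [::]) => c; rewrite big1; first by rewrite /psum big_nil.
by move=> j _; rewrite psum_pmul big_nil.
Qed.

Lemma inG_peq r (g : 'I_r -> mpol k n) f f' : (forall c, psum f c = psum f' c) ->
  inG g f' -> inG g f.
Proof. by move=> e /inGP[h H]; apply/inGP; exists h => c; rewrite e H. Qed.

Definition pscale (x : k) f : mpol k n := [seq (x * t.1, t.2) | t <- f].

Lemma psum_pscale x f c : psum (pscale x f) c = x * psum f c.
Proof.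
by rewrite /psum big_map mulr_sumr; apply: eq_bigr => t _; rewrite mulrA.
Qed.

Lemma inG_pscale r (g : 'I_r -> mpol k n) x f : inG g f -> inG g (pscale x f).
Proof.
move=> /inGP[h H]; apply/inGP; exists (fun j => pscale x (h j)) => c.
rewrite psum_pscale H mulr_sumr; apply: eq_bigr => j _.
rewrite !psum_pmul big_map mulr_sumr; apply: eq_bigr => s _; exact: mulrA.
Qed.

Lemma inG_shift r (g : 'I_r -> mpol k n) j ga : inG g (pmul [:: (1, ga)] (g j)).
Proof.
apply/inGP; exists (fun i => if i == j then [:: (1, ga)] else [::]) => c.
rewrite (bigD1 j) //= eqxx big1 ?addr0 // => i /negPf ->.
by rewrite psum_pmul big_nil.
Qed.

Lemma inG_gen r (g : 'I_r -> mpol k n) j : inG g (g j).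
Proof.
apply: inG_peq (inG_shift g j [ffun=> 0%N]) => c.
rewrite psum_pmul big_seq1 mul1r; apply: eq_psum => al /=; congr c.
by apply/ffunP => i; rewrite !ffunE.
Qed.

(* Modulo [g] every monomial may be replaced by a representative depending
   only on its image degree, and an element of the toric ideal then vanishes. *)
Lemma toric_generated r (g : 'I_r -> mpol k n) : (forall j, inIA a (g j)) ->
  (forall al be, imexp a al = imexp a be -> inG g (bin al be)) ->
  forall f, inIA a f <-> inG g f.
Proof.
move=> gI H f; split=> [fI|[h fh]]; last exact: inIA_peq fh (inIA_lincomb _ gI).
pose P al be := imexp a be == imexp a al.
(* Among seeds satisfying it, [choose] depends only on the predicate, so monomials of equal degree
   get the same representative. *)
pose nf al := choose (P al) al.
have PP al : P al al by exact: eqxx.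
have nfE al : imexp a (nf al) = imexp a al by apply/eqP; exact: (chooseP (PP al)).
have nfc al be : imexp a al = imexp a be -> nf al = nf be.
  move=> e; rewrite /nf; have -> : P al = P be by rewrite /P e.
  by apply: choose_id; rewrite // /P e.
apply: (@inG_peq _ _ _ (flatten [seq pscale t.1 (bin t.2 (nf t.2)) | t <- f])).
  move=> c; transitivity (psum f (fun al => c al - c (nf al))).
    rewrite -[LHS]subr0 -[X in _ - X](inIA_psum fI (c := c \o nf)); last first.
      by move=> al be /nfc /= ->.
    by rewrite /psum -sumrB; apply: eq_bigr => t _; rewrite mulrBr.
  rewrite {2}/psum big_flatten big_map; apply: eq_bigr => t _.
  by rewrite -[RHS]/(psum _ _) psum_pscale psum_bin.
elim: f {fI} => [|t f IH]; first exact: inG_nil.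
by apply: (inG_cat _ IH); apply/inG_pscale/H.
Qed.

Lemma inG_bin_trans r (g : 'I_r -> mpol k n) al be ga :
  inG g (bin al be) -> inG g (bin be ga) -> inG g (bin al ga).
Proof.
move=> x y; apply: inG_peq (inG_cat x y) => c.
by rewrite psum_cat !psum_bin addrA subrK.
Qed.

Lemma inG_bin_sym r (g : 'I_r -> mpol k n) al be :
  inG g (bin al be) -> inG g (bin be al).
Proof.
move=> x; apply: inG_peq (inG_pscale (-1) x) => c.
by rewrite psum_pscale !psum_bin mulN1r opprB.
Qed.

Lemma inG_bin_refl r (g : 'I_r -> mpol k n) al : inG g (bin al al).
Proof.
apply: inG_peq (inG_nil g) => c.
by rewrite psum_bin subrr /psum big_nil.
Qed.

End Toric.
End Functionals.

(** * Isolated monomials *)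

Section Fibers.
Variables (m n : nat) (a : 'I_n -> 'I_m -> nat).
Implicit Types (u v w al be : mono n).

(** Non-trivial fibre: [u] is not alone in its degree, so it occurs in some binomial of the toric
    ideal. *)
Definition nt u := exists2 w, imexp a w = imexp a u & w <> u.

(* [iso u] says that [u] is a connected component on its own of the graph of
   monomials of the same degree, joined when they share a variable. *)
Definition iso u := forall w, imexp a w = imexp a u -> w <> u ->
  forall i, (0 < u i)%N -> w i = 0%N.

Lemma mX1_le al i : (0 < al i)%N -> forall j, (mX i 1 j <= al j)%N.
Proof. by move=> gt0 j; rewrite ffunE; case: eqP => // ->. Qed.

(** A second monomial [w] of the same degree sharing [x_i] with [u] yields, after division by [x_i],
    a companion of [u / x_i]. *)
Lemma iso_of_divisors u :
  (forall i, (0 < u i)%N -> ~ nt (msub u (mX i 1))) -> iso u.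
Proof.
move=> H w ew ne i ui; case: (posnP (w i)) => // wi; case: (H i ui).
move: ew ne; rewrite -{1 2}(msubK (mX1_le ui)) -{1 2}(msubK (mX1_le wi)).
rewrite !imexp_madd => /maddIl e ne; exists (msub w (mX i 1)) => // e2.
by apply: ne; rewrite e2.
Qed.

(** Fix a term [x^ga] of [p] with [ga] nonzero. If [ga + al = u] and [be] has the degree of [al],
    then [ga + be] has the degree of [u] and shares a variable with it, hence equals [u]. So the
    coefficient of [x^u] in [x^ga q] is a functional of [q] constant on fibres, which vanishes. *)
Lemma pcoef_pmul_iso (k : fieldType) (p q : mpol k n) u : inIA a q -> iso u ->
  pcoef (pmul p q) u = pcoef p [ffun=> 0%N] * pcoef q u.
Proof.
move=> qI uI; rewrite !pcoefE psum_pmul [psum p _]/psum mulr_suml.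
apply: eq_bigr => -[x ga] _ /=; rewrite -mulrA; congr (_ * _).
have [->|ne0] := eqVneq ga [ffun=> 0%N].
  rewrite mul1r; apply: eq_psum => be; congr (_ == _)%:R.
  by apply/ffunP => i; rewrite !ffunE.
rewrite mul0r; apply: (inIA_psum qI) => al be e.
have [i gai] : exists i, (0 < ga i)%N.
  apply/existsP; apply: contraNT ne0 => /existsPn H; apply/eqP/ffunP => i.
  by move: (H i); rewrite ffunE lt0n negbK => /eqP.
have key al' be' : imexp a al' = imexp a be' -> madd ga al' = u -> al' = be'.
  move=> e' eu; apply/eqP; apply: contraT => ne.
  have /(_ _ _ i) := uI (madd ga be').
  have -> : imexp a (madd ga be') = imexp a u by rewrite -eu !imexp_madd e'.
  rewrite -eu !ffunE => /(_ erefl) H; suff: (ga i + be' i)%N = 0%N by lia.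
  by apply: H; [move/maddIl => e2; rewrite e2 eqxx in ne|lia].
congr ((nat_of_bool _)%:R); apply/eqP/eqP; first by move=> /[dup] /(key _ _ e) ->.
by move=> /[dup] /(key _ _ (esym e)) ->.
Qed.

(** The binomials [u - v], with [v] outside [U], have the identity as matrix of coefficients on [U].
    By isolation this matrix is the product of the constant terms of the multipliers with the
    coefficients of the [g_j], so its size is at most [r]. *)
Lemma iso_bound (k : fieldType) r (g : 'I_r -> mpol k n) (U : seq (mono n)) :
  (forall f, inIA a f <-> inG g f) -> uniq U ->
  (forall u, u \in U -> iso u) ->
  (forall u, u \in U -> exists2 v, imexp a v = imexp a u & v \notin U) ->
  (size U <= r)%N.
Proof.
move=> gen uU isoU exv; have gI j : inIA a (g j) by apply/gen/inG_gen.
pose u (i : 'I_(size U)) := tnth (in_tuple U) i.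
have uinj : injective u by exact/(tuple_uniqP (in_tuple U)).
have uU' i : u i \in U by exact: mem_tnth.
have ex i : exists h : 'I_r -> mpol k n, forall l,
    \sum_j pcoef (pmul (h j) (g j)) (u l) = (i == l)%:R.
  have [v ev vU] := exv _ (uU' i).
  have /gen/inGP[h H] := inIA_bin k (esym ev); exists h => l.
  rewrite (eq_bigr (fun j => psum (pmul (h j) (g j)) (fun be => (be == u l)%:R))).
    rewrite -H psum_bin; have -> : (v == u l) = false.
      by apply: contraNF vU => /eqP ->.
    by rewrite subr0 (inj_eq uinj).
  by move=> j _; rewrite pcoefE.
have [h H] := choice ex.
apply: (@mulmx1_min k _ _ (\matrix_(i, j) pcoef (h i j) [ffun=> 0%N])
  (\matrix_(j, l) pcoef (g j) (u l))).
apply/matrixP => i l; rewrite !mxE -H; apply: eq_bigr => j _.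
by rewrite !mxE pcoef_pmul_iso //; apply: isoU.
Qed.

(** * Isolated monomials of a complete intersection *)

Section CompleteIntersection.
Variables (k : fieldType) (r : nat) (g : 'I_r -> mpol k n).
Hypothesis gen : forall f, inIA a f <-> inG g f.
Variable F : seq (mono n).
Hypothesis rF : (r <= size F)%N.
Hypothesis isoF : forall u, u \in F -> iso u.
Hypothesis ntF : forall u, u \in F -> nt u.
Hypothesis uF : uniq (map (imexp a) F).

Lemma imexp_inj_in u v : u \in F -> v \in F -> imexp a u = imexp a v -> u = v.
Proof.
move=> uF1 vF e.
have : nth (imexp a v) (map (imexp a) F) (index u F) ==
       nth (imexp a v) (map (imexp a) F) (index v F).
  by rewrite !(nth_map v) ?index_mem // !nth_index // e.
rewrite nth_uniq ?size_map ?index_mem // => /eqP eij.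
by rewrite -(nth_index v uF1) eij nth_index.
Qed.

(** A new degree would make [w :: F] a family of more than [r] isolated monomials; as its degrees
    are distinct, any companion of a member lies outside it. *)
Lemma iso_degree w : iso w -> nt w -> exists2 u, u \in F & imexp a u = imexp a w.
Proof.
move=> wI wN; case: (boolP (imexp a w \in map (imexp a) F)) => [/mapP[u ? ->]|nw].
  by exists u.
suff : (size (w :: F) <= r)%N by rewrite /= ltnNge rF.
have wF : w \notin F by apply: contraNN nw => ?; rewrite map_f.
apply: (iso_bound gen) => /=.
- by rewrite wF (map_uniq uF).
- by move=> u; rewrite inE => /orP[/eqP -> //|]; apply: isoF.
move=> u uF'; have [v ev ne] : nt u.
  by move: uF'; rewrite inE => /orP[/eqP -> //|]; apply: ntF.
exists v => //; apply/negP => vF; move: uF' vF; rewrite !inE.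
case: (eqVneq u w) => [eu _|neu /= uF'].
  case: eqP => [ev'|_ /= vF]; first by case: ne; rewrite eu.
  by move: nw; rewrite -eu -ev map_f.
case: eqP => [ev'|_ /= vF]; first by move: nw; rewrite -ev' ev map_f.
exact/ne/imexp_inj_in.
Qed.

(** Trade the at most one member of [F] of this degree for [w1] and [w2]: the family grows beyond
    [r], and [w3], which stays outside, is a companion of both. *)
Lemma iso_at_most_two w1 w2 w3 : iso w1 -> iso w2 ->
  imexp a w1 = imexp a w3 -> imexp a w2 = imexp a w3 ->
  w1 <> w2 -> w1 <> w3 -> w2 <> w3 -> False.
Proof.
move=> I1 I2 e1 e2 n12 n13 n23.
pose F' := [seq u <- F | imexp a u != imexp a w3].
have sF' : (size F <= (size F').+1)%N.
  rewrite size_filter -(size_map (imexp a)).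
  rewrite -(count_predC (pred1 (imexp a w3)) (map (imexp a) F)).
  rewrite (count_uniq_mem _ uF) count_map.
  by rewrite -[in X in (_ <= X)%N]add1n leq_add // leq_b1.
suff : (size (w1 :: w2 :: F') <= r)%N by move: rF sF' => /=; lia.
have nF w u : imexp a w = imexp a w3 -> u \in F' -> u != w.
  by move=> e; rewrite mem_filter => /andP[H _]; apply: contraNN H => /eqP ->; apply/eqP.
apply: (iso_bound gen) => /=.
- rewrite inE negb_or (introN eqP n12) filter_uniq ?(map_uniq uF) // !andbT /=.
  by apply/andP; split; apply/negP => /nF; [move=> /(_ _ e1)|move=> /(_ _ e2)];
     rewrite eqxx.
- move=> u; rewrite !inE => /or3P[/eqP -> //|/eqP -> //|].
  by rewrite mem_filter => /andP[_]; apply: isoF.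
have w3n : w3 \notin [:: w1, w2 & F'].
  rewrite !inE !negb_or; apply/and3P; split.
  - by apply/eqP => e; case: n13.
  - by apply/eqP => e; case: n23.
  - by apply/negP => /(nF w3 _ erefl); rewrite eqxx.
move=> u; rewrite !inE => /or3P[/eqP ->|/eqP ->|uF']; [by exists w3|by exists w3|].
have [uF'' ] : u \in F /\ imexp a u != imexp a w3.
  by move: uF'; rewrite mem_filter => /andP[].
move=> ne; have [v ev nev] := ntF uF''; exists v => //.
rewrite !inE !negb_or; apply/and3P; split.
- by apply: contraNN ne => /eqP e; rewrite -ev e e1.
- by apply: contraNN ne => /eqP e; rewrite -ev e e2.
apply/negP; rewrite mem_filter => /andP[_ vF].
exact/nev/imexp_inj_in.
Qed.

End CompleteIntersection.
End Fibers.

(** * Simplicial data, decomposable variables and the Jacobian criterion *)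

Section Simplicial.
Variables (m n d : nat) (a : 'I_n -> 'I_m -> nat).
Hypothesis S : simplicial_data d a.
Implicit Types (i j q : 'I_n) (u v w al be : mono n).

Lemma simplicial_gt0 : (0 < d)%N. Proof. by case: S => -[]. Qed.

Lemma simplicial_lt : (m < n)%N. Proof. by case: S => -[]. Qed.

Lemma simplicial_inj i i' : (forall l, a i l = a i' l) -> i = i'.
Proof. by case: S => _ inj _ _ _ e; apply: inj; apply/funext. Qed.

Lemma simplicial_vertex i l : (i < m)%N -> a i l = (if val l == val i then d else 0)%N.
Proof. by case: S => _ _ _ H _; apply: H. Qed.

Lemma simplicial_sum i : (\sum_(l < m) a i l = d)%N.
Proof.
case: (ltnP i m) => [im|mi]; last by case: S => _ _ _ _; apply.
rewrite (bigD1 (Ordinal im)) //= simplicial_vertex // eqxx big1 ?addn0 // => l ne.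
rewrite simplicial_vertex //=.
by case: eqP => // e; case/eqP: ne; apply/val_inj.
Qed.

Lemma imexp_sum w : (\sum_l imexp a w l = tdeg w * d)%N.
Proof.
rewrite (eq_bigr (fun l => \sum_i w i * a i l)%N) => [|l _]; last by rewrite ffunE.
rewrite exchange_big big_distrl /=; apply: eq_bigr => i _.
by rewrite -big_distrr /= simplicial_sum.
Qed.

Lemma simplicial_tdeg al be : imexp a al = imexp a be -> tdeg al = tdeg be.
Proof.
by move=> e; apply/eqP; rewrite -(eqn_pmul2r simplicial_gt0) -!imexp_sum e.
Qed.

Lemma simplicial_face i (im : (i < m)%N) j :
  (forall l, l != Ordinal im -> a j l = 0%N) -> j = i.
Proof.
move=> H; apply: simplicial_inj => l; rewrite (simplicial_vertex _ im).
case: eqP => [e|ne]; last by apply: H; apply/eqP => e; apply: ne; rewrite e.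
have -> : l = Ordinal im by apply/val_inj.
by rewrite -(simplicial_sum j) (bigD1 (Ordinal im)) //= big1 ?addn0.
Qed.

(** The degree lies on the ray of [e_i], so every variable of [w] has its exponent vector on that
    ray, and only [x_i] does; the total degree then fixes the power. *)
Lemma vertex_fiber i N w : (i < m)%N -> imexp a w = imexp a (mX i N) -> w = mX i N.
Proof.
move=> im e.
have w0 j : j != i -> w j = 0%N.
  move=> ne; case: (posnP (w j)) => // wj; case/eqP: ne.
  apply: (simplicial_face (im := im)) => l nl.
  have /ffunP/(_ l) := e; rewrite imexp_mX simplicial_vertex //.
  rewrite ifN ?muln0; last by apply: contraNN nl => /eqP ?; apply/eqP/val_inj.
  rewrite ffunE (bigD1 j) //= => /eqP; rewrite addn_eq0 muln_eq0 => /andP[/orP[]] /eqP //.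
  by lia.
apply/ffunP => j; rewrite ffunE; case: eqP => [->|/eqP /w0 //].
have := simplicial_tdeg e; rewrite tdeg_mX => <-.
by rewrite /tdeg (bigD1 i) //= big1 ?addn0.
Qed.

Lemma vertex_power_not_nt i N : (i < m)%N -> ~ nt a (mX i N).
Proof. by move=> im [w /(vertex_fiber im) ->]. Qed.

Lemma not_nt_mX1 q : ~ nt a (mX q 1).
Proof.
move=> [w e ne]; have := simplicial_tdeg e; rewrite tdeg_mX => t1.
have [i wi] : exists i, (0 < w i)%N.
  apply/existsP; apply: contraPT t1 => /existsPn H.
  rewrite /tdeg big1 // => i _; by move: (H i); rewrite lt0n negbK => /eqP.
have ew : w = mX i 1.
  have /eqP : tdeg (msub w (mX i 1)) = 0%N.
    by move: t1; rewrite -{1}(msubK (mX1_le wi)) tdeg_madd tdeg_mX => -[].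
  rewrite sum_nat_eq0 => /forallP H.
  rewrite -(msubK (mX1_le wi)); apply/ffunP => j; rewrite ffunE.
  by have /implyP/(_ isT)/eqP -> := H j; rewrite addn0.
apply: ne; rewrite ew; congr mX; apply: simplicial_inj => l.
by move/ffunP/(_ l): e; rewrite ew !imexp_mX !mul1n.
Qed.

Lemma not_nt0 u : tdeg u = 0%N -> ~ nt a u.
Proof.
move=> u0 [w /simplicial_tdeg]; rewrite u0 => w0; apply; apply/ffunP => i.
move: u0 w0 => /eqP + /eqP; rewrite !sum_nat_eq0 => /forallP/(_ i)/eqP -> /forallP/(_ i)/eqP -> //.
Qed.

Definition vx (l : 'I_m) : 'I_n := widen_ord (ltnW simplicial_lt) l.

Lemma sum_vx (F : 'I_n -> nat) :
  (forall i, (m <= i)%N -> F i = 0%N) -> (\sum_i F i = \sum_l F (vx l))%N.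
Proof.
move=> F0; rewrite (bigID (fun i : 'I_n => (i < m)%N)) /= [X in (_ + X)%N]big1 ?addn0.
  rewrite (big_ord_narrow (ltnW simplicial_lt)) //.
by move=> i; rewrite -leqNgt; exact: F0.
Qed.

Lemma nonvertex_power_nt q : (m <= q)%N -> nt a (mX q d).
Proof.
(* Since [d a_q] is the sum of the [a q l] times [d e_l], the companion is the product of the vertex
   variables [x_l] to the powers [a q l]. *)
move=> mq; exists [ffun i => \sum_(l < m | val l == val i) a q l]%N.
  apply/ffunP => j; rewrite imexp_mX ffunE sum_vx; last first.
    move=> i mi; rewrite ffunE big_pred0 ?mul0n // => l; apply/negP => /eqP e.
    by have := ltn_ord l; rewrite [nat_of_ord l]e ltnNge mi.
  rewrite (bigD1 j) //= big1 ?addn0; last first.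
    move=> l ne; rewrite simplicial_vertex /=; last exact: ltn_ord.
    by case: eqP => [e|]; rewrite ?muln0 //; case/eqP: ne; apply/val_inj.
  rewrite simplicial_vertex /= ?ltn_ord // eqxx ffunE (big_pred1 j) // mulnC //.
move=> /ffunP/(_ q); rewrite !ffunE eqxx big_pred0 => [e|l].
  by have := simplicial_gt0; rewrite -e.
by apply/negP => /eqP e; have := ltn_ord l; rewrite [nat_of_ord l]e ltnNge mq.
Qed.

(** Take [c] least: the only quotient of [x_q^c] by a variable is [x_q^(c-1)], alone in its degree
    by minimality. The powers [0] and [1] are always alone. *)
Lemma exists_iso_power q : (m <= q)%N ->
  exists c, [/\ (1 < c)%N, iso a (mX q c) & nt a (mX q c)].
Proof.
move=> mq; have ex : exists c, `[< nt a (mX q c) >].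
  by exists d; apply/asboolP/nonvertex_power_nt.
case: (ex_minnP ex) => c /asboolP ntc minc; exists c; split=> //.
  case: c ntc {minc} => [|[|c]] // H; last by case: (not_nt_mX1 H).
  by case: (not_nt0 _ H); rewrite tdeg_mX.
apply: iso_of_divisors => i; rewrite ffunE; case: eqP => // -> c0.
have -> : msub (mX q c) (mX q 1) = mX q c.-1.
  by apply/ffunP => j; rewrite !ffunE; case: eqP; rewrite ?subn1.
by move=> /asboolP /minc; lia.
Qed.

(** In the chart [x_i = 1] at a vertex, such an [x_j] equals a monomial in other variables. These
    [j] index the Jacobian columns that may be nonzero at the vertex. *)
Definition decomp i : {set 'I_n} :=
  [set j | `[< exists N, nt a (madd (mX j 1) (mX i N)) >]].

(** Take [N] least. Dividing by [x_j] leaves a power of the vertex variable and dividing by [x_i]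
    lowers [N]; both quotients are alone in their degrees. *)
Lemma decomp_iso i j : (i < m)%N -> j \in decomp i ->
  exists N, [/\ (0 < N)%N, j != i, iso a (madd (mX j 1) (mX i N)) &
    nt a (madd (mX j 1) (mX i N))].
Proof.
move=> im; rewrite inE => /asboolP[N0 ntN0].
have ex : exists N, `[< nt a (madd (mX j 1) (mX i N)) >].
  by exists N0; apply/asboolP.
case: (ex_minnP ex) => N /asboolP ntN minN; exists N.
have ne : j != i.
  apply: contraPneq ntN => ->; suff -> : madd (mX i 1) (mX i N) = mX i N.+1.
    exact: vertex_power_not_nt.
  by apply/ffunP => l; rewrite !ffunE; case: eqP.
have N0' : (0 < N)%N.
  rewrite lt0n; apply: contraPneq ntN => ->.
  suff -> : madd (mX j 1) (mX i 0) = mX j 1 by exact: not_nt_mX1.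
  by apply/ffunP => l; rewrite !ffunE; case: (l == i); rewrite addn0.
split=> //; apply: iso_of_divisors => l; rewrite !ffunE.
case: (eqVneq l j) => [-> _|nlj].
  suff -> : msub (madd (mX j 1) (mX i N)) (mX j 1) = mX i N.
    exact: vertex_power_not_nt.
  by apply/ffunP => x; rewrite !ffunE addKn.
case: (eqVneq l i) => // -> _.
suff -> : msub (madd (mX j 1) (mX i N)) (mX i 1) = madd (mX j 1) (mX i N.-1).
  by move=> /asboolP /minN; lia.
apply/ffunP => x; rewrite !ffunE; case: (eqVneq x i) => [->|]; rewrite ?subn0 //.
by rewrite eq_sym (negPf ne) subn1.
Qed.

Lemma decomp_family i : (i < m)%N -> exists (F : seq (mono n)) (N : 'I_n -> nat),
  [/\ (#|decomp i| <= size F)%N,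
      forall u, u \in F -> iso a u,
      forall u, u \in F -> nt a u,
      uniq (map (imexp a) F) &
      forall u, u \in F -> exists j,
        [/\ (0 < N j)%N, j != i & u = madd (mX j 1) (mX i (N j))]].
Proof.
move=> im; have ex j : exists N, j \in decomp i ->
   [/\ (0 < N)%N, j != i, iso a (madd (mX j 1) (mX i N)) &
    nt a (madd (mX j 1) (mX i N))].
  case: (boolP (j \in decomp i)) => [/(decomp_iso im)[N H]|]; first by exists N.
  by exists 0%N.
have [N HN] := choice ex.
exists [seq madd (mX j 1) (mX i (N j)) | j <- enum (decomp i)], N; split.
- by rewrite size_map -cardE.
- by move=> u /mapP[j]; rewrite mem_enum => /HN[_ _ ? _] ->.
- by move=> u /mapP[j]; rewrite mem_enum => /HN[_ _ _ ?] ->.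
(* Equal degrees have equal total degrees, hence equal powers of [x_i]; cancelling them leaves
   [a j = a j']. *)
- rewrite -map_comp map_inj_in_uniq ?enum_uniq // => j j' _ _ /= e.
  apply: simplicial_inj => l.
  have := simplicial_tdeg e; rewrite !tdeg_madd !tdeg_mX => /addnI eN.
  move: e; rewrite !imexp_madd eN maddC [RHS]maddC => /maddIl/ffunP/(_ l).
  by rewrite !imexp_mX !mul1n.
move=> u /mapP[j]; rewrite mem_enum => jD ->; exists j.
by have [? ? _ _] := HN _ jD; split.
Qed.

(** * Jacobian criterion at the vertices *)

Section Singular.
Variable k : fieldType.

Definition upt i : 'I_n -> k := fun j => (j == i)%:R.

Lemma mev_upt i al : mev (upt i) al = (al == mX i (al i))%:R.
Proof.
rewrite /mev; case: eqP => [->|ne].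
  rewrite big1 // => j _; rewrite /upt ffunE; case: eqP => _.
    by rewrite expr1n.
  by rewrite expr0.
have [j /andP[nji aj]] : exists j, (j != i) && (al j != 0%N).
  apply/existsP; apply: contra_notT ne => /existsPn H; apply/ffunP => j.
  rewrite ffunE; case: eqP => [-> //|/eqP ne]; move: (H j).
  by rewrite ne negbK => /eqP.
by rewrite (bigD1 j) //= /upt (negPf nji) expr0n (negPf aj) mul0r.
Qed.

Lemma upt_inV i : (i < m)%N -> inV a (upt i).
Proof.
move=> im f fI; rewrite pevalE (inIA_psum fI) // => al be e; rewrite !mev_upt.
congr ((nat_of_bool _)%:R); apply/eqP/eqP => H.
  by have := e; rewrite H => /esym /(vertex_fiber im) ->; rewrite ffunE eqxx.
by have := e; rewrite H => /(vertex_fiber im) ->; rewrite ffunE eqxx.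
Qed.

(** At this point the derivative along [x_j] sees only the monomials [x_j x_i^N]. For [j] outside
    [decomp i] each is alone in its degree, so it has coefficient zero in [f]. *)
Lemma jacobian_upt i j f : (i < m)%N -> inIA a f -> j \notin decomp i ->
  peval (pderiv f j) (upt i) = 0 :> k.
Proof.
move=> im fI jD; rewrite peval_pderiv (inIA_psum fI) //.
suff key al be : imexp a al = imexp a be -> al <> be ->
    (al j)%:R * mev (upt i) (msub al (mX j 1)) = 0 :> k.
  move=> al be e; case: (eqVneq al be) => [-> //|/eqP ne].
  by rewrite (key _ _ e ne) (key _ _ (esym e)) // => /esym.
move=> e ne; rewrite mev_upt; case: (posnP (al j)) => [->|alj]; first by rewrite mul0r.
case: eqP => [H|]; last by rewrite mulr0.
move: jD; rewrite inE => /asboolP []; exists (msub al (mX j 1) i).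
by rewrite -H msubK; [exists be => // /esym | exact: mX1_le].
Qed.

(** The columns outside [decomp i] vanish, so the Jacobian matrix of rank [n - m] factors through a
    space of dimension [#|decomp i|]. *)
Lemma nonsingular_decomp i : (i < m)%N -> ~ singular_pt a (upt i) ->
  (n - m <= #|decomp i|)%N.
Proof.
move=> im ns.
have [f [fI rk]] : exists f : 'I_(n - m) -> mpol k n,
  (forall l, inIA a (f l)) /\
  \rank (\matrix_(l < n - m, j < n) peval (pderiv (f l) j) (upt i)) = (n - m)%N.
  apply: contra_notP ns => ns; split=> //; first exact: upt_inV.
  move=> /(congr1 (fun x => x i)); rewrite /upt eqxx => /eqP.
  by rewrite oner_eq0.
rewrite -{1}rk; set J := \matrix_(_, _) _.
pose A := \matrix_(l < n - m, x < #|decomp i|) J l (enum_val x).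
pose B := \matrix_(x < #|decomp i|, j < n) ((enum_val x == j)%:R : k).
have -> : J = A *m B.
  apply/matrixP => l j; rewrite !mxE.
  case: (boolP (j \in decomp i)) => jD.
    rewrite (bigD1 (enum_rank_in jD j)) //= big1 ?addr0 => [|x ne].
      by rewrite !mxE enum_rankK_in // eqxx mulr1.
    rewrite !mxE; case: eqP => [e|]; last by rewrite mulr0.
    by case/eqP: ne; apply: enum_val_inj; rewrite enum_rankK_in.
  rewrite jacobian_upt // big1 // => x _; rewrite !mxE.
  case: eqP => [e|]; last by rewrite mulr0.
  by move: jD; rewrite -e enum_valP.
by apply: leq_trans (mxrankM_maxl _ _) (rank_leq_col _).
Qed.

Lemma singular_vertex_unique i i' : one_singular_point k a ->
  singular_pt a (upt i) -> singular_pt a (upt i') -> i = i'.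
Proof.
move=> [p [_ H]] /H[c ec] /H[c' ec']; apply/eqP; apply: contraT => ne.
have e1 : c * p i = 1 by rewrite -(congr1 (@^~ i) ec) /upt eqxx.
have e2 : c * p i' = 0.
  by rewrite -(congr1 (@^~ i') ec) /upt eq_sym (negPf ne).
have e3 : c' * p i' = 1 by rewrite -(congr1 (@^~ i') ec') /upt eqxx.
have c0 : c != 0 by apply: contra_eq_neq e1 => ->; rewrite mul0r eq_sym oner_eq0.
move/eqP: e2; rewrite mulf_eq0 (negPf c0) /= => /eqP p0.
by move/eqP: e3; rewrite p0 mulr0 eq_sym oner_eq0.
Qed.

End Singular.
End Simplicial.

(** * Kernels of the degree map *)

Definition mperm n (s : 'I_n -> 'I_n) (al : mono n) : mono n := [ffun l => al (s l)].

(** Combinatorial counterpart of [same_up_to_perm]: up to renaming variables, [a] and [b] have the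
    same binomial relations, hence the same toric ideal. *)
Definition same_ker m m' n (s : 'I_n -> 'I_n)
    (a : 'I_n -> 'I_m -> nat) (b : 'I_n -> 'I_m' -> nat) :=
  forall al be, imexp a al = imexp a be <-> imexp b (mperm s al) = imexp b (mperm s be).

Lemma mpermK n (s : {perm 'I_n}) al : mperm s (mperm (s^-1)%g al) = al.
Proof. by apply/ffunP => i; rewrite !ffunE permK. Qed.

Lemma mperm_inj n (s : {perm 'I_n}) : injective (mperm s).
Proof.
by move=> al be /ffunP e; apply/ffunP => i; move: (e (s^-1 i)%g); rewrite !ffunE permKV.
Qed.

Section Kernels.
Variables (m m' n : nat) (s : {perm 'I_n}).
Variables (a : 'I_n -> 'I_m -> nat) (b : 'I_n -> 'I_m' -> nat).

Lemma same_ker_scaled (c : nat) (pi : 'I_m' -> 'I_m) : (0 < c)%N ->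
  (forall j, exists j', pi j' = j) -> (forall l j, a (s l) (pi j) = c * b l j)%N ->
  same_ker s a b.
Proof.
move=> c0 surj ab al be.
have E w j : imexp a w (pi j) = (c * imexp b (mperm s w) j)%N.
  rewrite !ffunE (reindex_inj (@perm_inj _ s)) /= big_distrr /=.
  by apply: eq_bigr => l _; rewrite ffunE ab mulnCA.
split=> /ffunP e; apply/ffunP => j.
  by apply/eqP; rewrite -(eqn_pmul2l c0) -!E e.
by have [j' <-] := surj j; rewrite !E e.
Qed.

Variable k : closedFieldType.

Lemma mev_perm (x : 'I_n -> k) al : mev (fun l => x (s l)) (mperm s al) = mev x al.
Proof.
rewrite /mev [RHS](reindex_inj (@perm_inj _ s)) /=.
by apply: eq_bigr => l _; rewrite ffunE.
Qed.

Lemma same_ker_inIA (f : mpol k n) : same_ker s a b ->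
  inIA a f <-> inIA b [seq (t.1, mperm s t.2) | t <- f].
Proof.
move=> sk; have E c : psum [seq (t.1, mperm s t.2) | t <- f] c = psum f (c \o mperm s).
  by rewrite /psum big_map.
split=> fI; apply: psum_inIA => c cc.
  by rewrite E (inIA_psum fI) // => al be /sk /cc.
transitivity (psum f ((c \o mperm (s^-1)%g) \o mperm s)).
  by apply: eq_psum => al /=; congr c; apply: (@mperm_inj _ s); rewrite mpermK.
rewrite -E (inIA_psum fI) // => al be e; apply: cc; apply/sk.
by rewrite !mpermK.
Qed.

Lemma same_ker_inV : same_ker s a b -> same_up_to_perm k a b.
Proof.
move=> sk; exists s => x.
have E f : peval f x = peval [seq (t.1, mperm s t.2) | t <- f] (fun l => x (s l)).
  rewrite !pevalE {2}/psum big_map; apply: eq_bigr => t _ /=.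
  by rewrite mev_perm.
split=> xV f fI; last by rewrite E xV //; apply/same_ker_inIA.
pose f' : mpol k n := [seq (t.1, mperm (s^-1)%g t.2) | t <- f].
have ef : [seq (t.1, mperm s t.2) | t <- f'] = f.
  rewrite -map_comp map_id_in // => -[y t] _ /=.
  by rewrite mpermK.
by rewrite -ef -E xV //; apply/same_ker_inIA => //; rewrite ef.
Qed.

End Kernels.

(** * Two smooth vertices *)

Section Forward.
Variables (k : closedFieldType) (m n d : nat) (a : 'I_n -> 'I_m -> nat).
Hypothesis S : simplicial_data d a.
Variables (g : 'I_(n - m) -> mpol k n).
Hypothesis gen : forall f, inIA a f <-> inG g f.

(** Let [x_q^c] be the least power not alone. It shares its degree with some [u = x_j x_P^N] and
    some [u' = x_j' x_P'^N']; three such monomials in one degree are too many, so [u = u']. This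
    forces [j = P'], [j' = P], [N = 1] and [c = 2]. *)
Lemma two_smooth_vertices (P P' : 'I_n) : (P < m)%N -> (P' < m)%N -> P != P' ->
  ~ singular_pt a (upt k P) -> ~ singular_pt a (upt k P') ->
  forall q : 'I_n, (m <= q)%N -> forall l, (2 * a q l = a P l + a P' l)%N.
Proof.
move=> Pm P'm neP sP sP' q mq l.
have [F [N [rF iF nF uF sF]]] := decomp_family S Pm.
have [F' [N' [rF' iF' nF' uF' sF']]] := decomp_family S P'm.
have := nonsingular_decomp S P'm sP' => /leq_trans/(_ rF') {rF'}rF'.
have := nonsingular_decomp S Pm sP => /leq_trans/(_ rF) {rF}rF.
have [c [c1 ic nc]] := exists_iso_power S mq.
have [u uIF eu] := iso_degree gen rF iF nF uF ic nc.
have [u' uIF' eu'] := iso_degree gen rF' iF' nF' uF' ic nc.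
have [j [N0 jP uE]] := sF u uIF; have [j' [N'0 j'P u'E]] := sF' u' uIF'.
have qP : P != q by apply: contraTneq mq => <-; rewrite -ltnNge.
have qP' : P' != q by apply: contraTneq mq => <-; rewrite -ltnNge.
have [uu'|ne] := eqVneq u u'; last first.
  case: (iso_at_most_two gen rF iF nF uF (iF _ uIF) (iF' _ uIF') eu eu').
  - exact/eqP.
  - move=> /ffunP/(_ P); rewrite uE !ffunE eqxx (negPf qP); lia.
  - move=> /ffunP/(_ P'); rewrite u'E !ffunE eqxx (negPf qP'); lia.
have /ffunP/(_ P) := uu'; rewrite uE u'E !ffunE eqxx (negPf neP) addn0.
rewrite (eq_sym P j) (negPf jP); case: eqP => [j'E|_]; last by lia.
move=> NE; have /ffunP/(_ P') := uu'.
rewrite uE u'E !ffunE eqxx (eq_sym P' P) (negPf neP) addn0.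
rewrite (eq_sym P' j') (negPf j'P) (eq_sym P' j); case: eqP => [jE _|_]; last by lia.
have := simplicial_tdeg S eu; rewrite uE tdeg_madd !tdeg_mX => cE.
move/ffunP/(_ l): eu; rewrite uE imexp_madd ffunE !imexp_mX -jE -cE.
by lia.
Qed.

End Forward.

(** * At least three parameters: the quadric surface *)

Section CaseSurface.
Variables (k : closedFieldType) (m n d : nat) (a : 'I_n -> 'I_m -> nat).
Hypothesis S : simplicial_data d a.
Hypothesis one : one_singular_point k a.
Hypothesis ci : ideal_ci k a.

Lemma exceptional_vertex : (0 < m)%N ->
  exists i0 : 'I_m, forall l : 'I_m, l != i0 -> ~ singular_pt a (upt k (vx S l)).
Proof.
move=> m0; have [[i0 si0]|ns] := pselect (exists l : 'I_m, singular_pt a (upt k (vx S l))).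
  exists i0 => l ne sl; case/eqP: ne; apply: val_inj.
  by have /(congr1 val) := singular_vertex_unique one sl si0.
(* If all vertices are smooth the exception is arbitrary. *)
by exists (Ordinal m0) => l _ sl; apply: ns; exists l.
Qed.

Lemma vx_inj : injective (vx S).
Proof. by move=> l l' /(congr1 val) /= /val_inj. Qed.

(** At least two vertices are smooth, so every non-vertex is their midpoint and there is only one.
    Three smooth vertices [x, y, z] would make it the midpoint of [x, y] and of [x, z], whence
    [y = z]; so [m - 1 = 2]. *)
Lemma surface_shape : (3 <= m)%N -> [/\ m = 3%N, n = 4%N &
  exists l1 l2, l1 != l2 /\ forall q : 'I_n, (m <= q)%N -> forall j,
    (2 * a q j = a (vx S l1) j + a (vx S l2) j)%N].
Proof.
move=> m3; have [g gen] := ci.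
have [i0 sm] := exceptional_vertex (ltn_trans (isT : 0 < 2)%N m3).
have mid (q : 'I_n) l l' j : (m <= q)%N -> l != i0 -> l' != i0 -> l != l' ->
    (2 * a q j = a (vx S l) j + a (vx S l') j)%N.
  move=> mq l0 l'0 ne.
  apply: (two_smooth_vertices S gen _ _ _ (sm _ l0) (sm _ l'0)) => //.
  - exact: (ltn_ord l).
  - exact: (ltn_ord l').
have card0 : #|[set l : 'I_m | l != i0]| = m.-1.
  by have := cardsC1 i0; rewrite card_ord => <-; apply: eq_card => l; rewrite !inE.
have /card_gt1P[l1 [l2 []]] : (1 < #|[set l : 'I_m | l != i0]|)%N by rewrite card0; lia.
rewrite !inE => l10 l20 ne12.
have nm : n = m.+1.
  apply/eqP; rewrite eqn_leq (simplicial_lt S) andbT leqNgt; apply/negP => lt.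
  have ltm := ltn_trans (ltnSn m) lt.
  suff e : Ordinal ltm = Ordinal lt by have /= := congr1 (@nat_of_ord n) e; lia.
  apply: (simplicial_inj S) => j; have := mid (Ordinal ltm) l1 l2 j (leqnn m) l10 l20 ne12.
  by rewrite -(mid (Ordinal lt) l1 l2 j) //=; lia.
have qn : (m < n)%N by rewrite nm.
pose q : 'I_n := Ordinal qn; have mq : (m <= q)%N by [].
have m3' : m = 3%N.
  apply/eqP; rewrite eqn_leq m3 andbT leqNgt; apply/negP => m4.
  have /card_gt2P[x [y [z [[]]]]] : (2 < #|[set l : 'I_m | l != i0]|)%N by rewrite card0; lia.
  rewrite !inE => x0 y0 z0 [xy yz zx]; case/eqP: yz; apply: vx_inj.
  apply: (simplicial_inj S) => j; have := mid q x y j mq x0 y0 xy.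
  by rewrite (mid q x z j) // 1?eq_sym // => /addnI.
split=> //; first by rewrite nm m3'.
by exists l1, l2; split=> // x mx j; apply: mid.
Qed.

End CaseSurface.

Lemma ord3_third (l1 l2 : 'I_3) : exists l3, (l3 != l1) && (l3 != l2).
Proof.
apply/existsP; apply: contraT => /existsPn H.
have : (#|'I_3| <= #|[set l1; l2]|)%N.
  apply/subset_leq_card/subsetP => l _; rewrite !inE.
  by have := H l; rewrite negb_and !negbK.
by rewrite card_ord cards2; case: (l1 != l2).
Qed.

Lemma surface_case (k : closedFieldType) d (a : 'I_4 -> 'I_3 -> nat)
  (S : simplicial_data d a) (l1 l2 : 'I_3) : l1 != l2 ->
  (forall j, 2 * a ord_max j = a (vx S l1) j + a (vx S l2) j)%N ->
  same_up_to_perm k a (@surfB 4).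
Proof.
move=> ne12 H; have [l3 /andP[ne31 ne32]] := ord3_third l1 l2.
pose pi (l : 'I_3) := if val l == 0%N then l1 else if val l == 1%N then l2 else l3.
have nel : [&& l1 != l2, l3 != l1 & l3 != l2] by apply/and3P.
have pi_inj : injective pi.
  move=> x y; rewrite /pi; case: x => [[|[|[|x]]] // xP]; case: y => [[|[|[|y]]] // yP] /= e;
  by [apply: val_inj | move: nel; rewrite e eqxx ?andbF].
pose f (l : 'I_4) : 'I_4 := if insub (val l) is Some x then vx S (pi x) else ord_max.
have f3 (l : 'I_4) : (3 <= l)%N -> f l = ord_max.
  by move=> l3'; rewrite /f insubF //= ltnNge l3'.
have flt (l : 'I_4) (lt : (l < 3)%N) : f l = vx S (pi (Ordinal lt)).
  by rewrite /f insubT.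
have vxm x : vx S x != ord_max by apply: contraTneq (ltn_ord x) => /(congr1 val) /= ->.
have f_inj : injective f.
  move=> x y; case: (ltnP x 3) => x3; case: (ltnP y 3) => y3.
  - by rewrite (flt _ x3) (flt _ y3) => /vx_inj /pi_inj [] /val_inj.
  - by rewrite (flt _ x3) (f3 _ y3) => /eqP; rewrite (negPf (vxm _)).
  - by rewrite (flt _ y3) (f3 _ x3) => /eqP; rewrite eq_sym (negPf (vxm _)).
  - move=> _; apply/val_inj/eqP; rewrite /= eqn_leq.
    by rewrite (leq_trans (leq_ord x) y3) (leq_trans (leq_ord y) x3).
have aE l j : a (vx S l) j = if j == l then d else 0%N.
  by rewrite (simplicial_vertex S) /= ?ltn_ord.
have ac1 : (2 * a ord_max l1 = d)%N by rewrite H !aE eqxx (negPf ne12) addn0.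
have ac2 : (2 * a ord_max l2 = d)%N by rewrite H !aE eqxx eq_sym (negPf ne12).
have ac3 : a ord_max l3 = 0%N.
  by apply/eqP; rewrite -(eqn_pmul2l (isT : 0 < 2)%N) H !aE (negPf ne31) (negPf ne32).
apply: (@same_ker_inV _ _ _ (perm f_inj)).
(* The scaling factor [a ord_max l1] is [d / 2], since the model has degree [2]. *)
apply: (@same_ker_scaled _ _ _ _ _ _ (a ord_max l1) pi).
- by have := simplicial_gt0 S; lia.
- by move=> j; exists (invF pi_inj j); rewrite f_invF.
move=> l j; rewrite permE /surfB; case: (ltnP l 3) => l3'.
  rewrite flt aE (inj_eq pi_inj) -val_eqE /=.
  by case: eqP; rewrite ?muln0 // mulnC.
rewrite f3 //.
case: j => [[|[|[|j]]] // jP]; rewrite /pi /= ?muln1 ?muln0 //.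
by lia.
Qed.

(** * One smooth vertex on a curve *)

(** The derivatives of [x_q^2 - x_P x_Q] along [x_P] and [x_Q] are [- x_Q] and [- x_P]; where both
    vanish so does [x_q], by the equation. Avoiding the derivative along [x_q] makes this work in
    every characteristic. *)
Lemma conic_smooth (k : closedFieldType) d (a : 'I_3 -> 'I_2 -> nat) (P Q q : 'I_3) p :
  simplicial_data d a -> uniq [:: P; Q; q] ->
  imexp a (mX q 2) = imexp a (madd (mX P 1) (mX Q 1)) -> ~ @singular_pt k 2 3 a p.
Proof.
move=> S; rewrite /= !inE negb_or andbT => /andP[/andP[PQ Pq] Qq] e [pV p0 ns].
have eP : (Q == P) = false by rewrite eq_sym (negPf PQ).
pose f := bin k (mX q 2) (madd (mX P 1) (mX Q 1)).
have fI : inIA a f by exact: inIA_bin.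
have all3 (j : 'I_3) : [|| j == P, j == Q | j == q].
  apply: contraT; rewrite !negb_or => /and3P[jP jQ jq].
  have u4 : uniq [:: j; P; Q; q] by rewrite /= !inE !negb_or jP jQ jq PQ Pq Qq.
  have := uniq_leq_size u4 (fun x _ => mem_ord_enum x).
  by rewrite -[X in (_ <= X)%N](size_map val) val_ord_enum size_iota.
have pPQ : (p P != 0) || (p Q != 0).
  apply: contra_notT p0; rewrite negb_or !negbK => /andP[/eqP pP /eqP pQ].
  have /eqP := pV f fI; rewrite pevalE psum_bin mev_madd !mev_mX pP mul0r subr0.
  rewrite expf_eq0 /= => /eqP pq; apply/funext => j.
  by case/or3P: (all3 j) => /eqP ->.
apply: ns; exists (fun=> f); split=> //; rewrite (@rank_rV k 3).
suff [j nz] : exists j, peval (pderiv f j) p != 0.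
  by case: eqP => // /rowP/(_ j); rewrite !mxE => /eqP; rewrite (negPf nz).
have D j : peval (pderiv f j) p = (mX q 2 j)%:R * mev p (msub (mX q 2) (mX j 1)) -
   (madd (mX P 1) (mX Q 1) j)%:R * mev p (msub (madd (mX P 1) (mX Q 1)) (mX j 1)).
  by rewrite peval_pderiv psum_bin.
case/orP: pPQ => nz; [exists Q|exists P]; rewrite D ?(maddC (mX P 1)).
  have -> : msub (madd (mX Q 1) (mX P 1)) (mX Q 1) = mX P 1.
    by apply/ffunP => x; rewrite !ffunE addKn.
  by rewrite mev_mX !ffunE eqxx eP (negPf Qq) mul0r add0r mul1r oppr_eq0.
have -> : msub (madd (mX Q 1) (mX P 1)) (mX P 1) = mX Q 1.
  by apply/ffunP => x; rewrite !ffunE addnK.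
by rewrite mev_mX !ffunE eqxx (negPf PQ) (negPf Pq) mul0r add0r mul1r oppr_eq0.
Qed.

Section CaseCurve.
Variables (k : closedFieldType) (n d : nat) (a : 'I_n -> 'I_2 -> nat).
Hypothesis S : simplicial_data d a.
Variables (g : 'I_(n - 2) -> mpol k n).
Hypothesis gen : forall f, inIA a f <-> inG g f.
Variables lP lQ : 'I_2.
Hypothesis lPQ : lP != lQ.
Let P := vx S lP.
Let Q := vx S lQ.
Hypothesis smP : ~ singular_pt a (upt k P).
(** Position on the segment from [P], at [0], to [Q], at [d]; it determines the variable. *)
Let e i := a i lQ.

Let ord2 (l : 'I_2) : l = lP \/ l = lQ.
Proof.
case: (eqVneq l lP) => [|ne]; first by left.
right; apply: val_inj; move: ne lPQ; rewrite -!val_eqE /=.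
by case: l lP lQ => [[|[|?]] // ?] [[|[|?]] // ?] [[|[|?]] // ?].
Qed.

Let aPE i : (a i lP + e i = d)%N.
Proof.
rewrite -(simplicial_sum S i) (bigD1 lP) //= (bigD1 lQ) /= 1?eq_sym // big1 ?addn0 //.
by move=> l /andP[l1 l2]; case: (ord2 l) l1 l2 => ->; rewrite eqxx.
Qed.

Let e_inj : injective e.
Proof.
move=> i i' ee; apply: (simplicial_inj S) => l.
by have := aPE i; rewrite -(aPE i') ee => /addIn; case: (ord2 l) => ->.
Qed.

Let eP0 : e P = 0%N.
Proof.
rewrite /e (simplicial_vertex S); last exact: (ltn_ord lP).
by rewrite (inj_eq val_inj) eq_sym (negPf lPQ).
Qed.

Let eQd : e Q = d.
Proof.
rewrite /e (simplicial_vertex S); last exact: (ltn_ord lQ).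
by rewrite eqxx.
Qed.

Let vertexPQ (i : 'I_n) : (i < 2)%N -> i = P \/ i = Q.
Proof.
move=> i2; have -> : i = vx S (Ordinal i2) by apply: val_inj.
by case: (ord2 (Ordinal i2)) => ->; [left|right].
Qed.

Let interior (i : 'I_n) : i != P -> i != Q -> (2 <= i)%N.
Proof. by rewrite leqNgt => nP nQ; apply/negP => /vertexPQ[] ei; move: nP nQ; rewrite ei eqxx. Qed.

(* [R i j] says that the least power of [x_i] not alone in its degree has the
   degree of the isolated monomial [x_j x_P^N] attached to [x_j]. *)
Let successor : exists R : 'I_n -> 'I_n -> Prop,
  [/\ forall i, i != P -> i != Q -> exists j, R i j,
      forall i j, R i j -> exists2 c, (1 < c)%N & (c * e i = e j)%N
    & forall i i' j, i != P -> i' != P -> R i j -> R i' j -> i = i'].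
Proof.
have [F [N [rF iF nF uF sF]]] := decomp_family S (ltn_ord lP : (P < 2)%N).
have {}rF := leq_trans (nonsingular_decomp S (ltn_ord lP : (P < 2)%N) smP) rF.
exists (fun i j => exists c, [/\ (1 < c)%N, iso a (mX i c), (0 < N j)%N,
  madd (mX j 1) (mX P (N j)) \in F &
  imexp a (madd (mX j 1) (mX P (N j))) = imexp a (mX i c)]); split.
- move=> i iP iQ; have [c [c1 ic nc]] := exists_iso_power S (interior iP iQ).
  have [u uIF eu] := iso_degree gen rF iF nF uF ic nc.
  have [j [N0 jP uE]] := sF u uIF; exists j, c; rewrite -uE; split=> //.
- move=> i j [c [c1 _ _ _ /ffunP/(_ lQ)]]; rewrite imexp_madd ffunE !imexp_mX => E.
  by exists c; rewrite // /e -E -/(e P) eP0 muln0 addn0 mul1n.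
move=> i i' j iP i'P [c [c1 ic N0 uIF eu]] [c' [c'1 ic' _ _ eu']].
apply/eqP; apply: contraT => ne.
(* Otherwise [x_i^c], [x_i'^c'] and [x_j x_P^N] would be three monomials of one degree, the third
   told apart by its positive power of [x_P]. *)
case: (iso_at_most_two gen rF iF nF uF ic ic' (esym eu) (esym eu')).
- move=> /ffunP/(_ i); rewrite !ffunE eqxx (negPf ne); lia.
- move=> /ffunP/(_ P); rewrite !ffunE eqxx eq_sym (negPf iP); lia.
- move=> /ffunP/(_ P); rewrite !ffunE eqxx eq_sym (negPf i'P); lia.
Qed.

(** The variables in order of position: rank [0] will be [P] and rank [n - 1] will be [Q]. *)
Let L := sort (fun i i' => e i <= e i')%N (enum 'I_n).
Let E r := e (nth P L r).

Let n3 : (2 < n)%N. Proof. exact: simplicial_lt S. Qed.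

Let sizeL : size L = n. Proof. by rewrite size_sort size_enum_ord. Qed.

Let uniqL : uniq L. Proof. by rewrite sort_uniq enum_uniq. Qed.

Let memL i : i \in L. Proof. by rewrite mem_sort mem_enum. Qed.

Let index_lt i : (index i L < n)%N.
Proof. by have := memL i; rewrite -index_mem sizeL. Qed.

Let E_lt r r' : (r < r')%N -> (r' < n)%N -> (E r < E r')%N.
Proof.
move=> rr' r'n; have st : sorted (relpre e ltn) L.
  rewrite -sorted_map ltn_sorted_uniq_leq map_inj_uniq // uniqL /= sorted_map.
  by apply: sort_sorted => i i'; apply: leq_total.
have tr : transitive (relpre e ltn) by move=> x y z; apply: ltn_trans.
by apply: (sorted_ltn_nth tr P st) => //; rewrite inE sizeL // (ltn_trans rr').
Qed.

Let nth0 : nth P L 0 = P.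
Proof.
have iP := index_lt P.
case: (posnP (index P L)) => [<-|i0]; first exact: nth_index.
by have := E_lt i0 iP; rewrite /E nth_index // eP0.
Qed.

Let nth_last : nth P L n.-1 = Q.
Proof.
have iQ := index_lt Q.
have [lt|ge] := ltnP (index Q L) n.-1.
  have := E_lt lt; rewrite /E nth_index // eQd => H; have {}H := H ltac:(lia); move: H.
  by move=> H; have := aPE (nth P L n.-1); lia.
by have -> : n.-1 = index Q L by [lia|]; rewrite nth_index.
Qed.

Let E0 : E 0 = 0%N. Proof. by rewrite /E nth0. Qed.
Let Elast : E n.-1 = d. Proof. by rewrite /E nth_last. Qed.

Let E_gt0 r : (0 < r)%N -> (r < n)%N -> (0 < E r)%N.
Proof. by move=> r0 rn; rewrite -E0 E_lt. Qed.

Let chain r : (0 < r)%N -> (r < n.-1)%N -> exists2 c, (1 < c)%N & (E r.+1 = c * E r)%N.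
Proof.
have [R [Rex Rmul Rinj]] := successor.
have ne x y : (x < y)%N -> (y < n)%N -> nth P L x != nth P L y.
  by move=> xy yn; apply: contraTneq (E_lt xy yn); rewrite /E => ->; rewrite ltnn.
have neP x : (0 < x)%N -> (x < n.-1)%N -> nth P L x != P.
  by move=> x0 xn; rewrite -[X in _ != X]nth0 eq_sym ne //; lia.
have neQ x : (0 < x)%N -> (x < n.-1)%N -> nth P L x != Q.
  by move=> x0 xn; rewrite -nth_last ne //; lia.
suff key : (0 < r)%N -> (r < n.-1)%N -> R (nth P L r) (nth P L r.+1).
  by move=> r0 rn; have [c c1 cE] := Rmul _ _ (key r0 rn); exists c.
(* Downward induction on the rank. If the successor of rank [r] had rank [s > r + 1], then rank
   [s - 1] would by induction have the same successor, against injectivity. *)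
have [x] := ubnP (n - r); elim: x r => // x IH r rx r0 rn.
have [j Rj] := Rex _ (neP _ r0 rn) (neQ _ r0 rn).
have jn := index_lt j.
have rj : (r < index j L)%N.
  have [c c1 cE] := Rmul _ _ Rj; rewrite ltnNge; apply/negP => le.
  have : (e j <= E r)%N.
    rewrite -(nth_index P (memL j)) -/(E _).
    by move: le; rewrite leq_eqVlt => /orP[/eqP -> //|lt]; rewrite ltnW // E_lt //; lia.
  have := E_gt0 r0 (ltn_trans rn (ltac:(lia) : (n.-1 < n)%N)).
  by rewrite -cE -/(E r); nia.
have [<-|neq] := eqVneq (index j L) r.+1; first by rewrite nth_index.
pose r' := (index j L).-1; have r'E : r'.+1 = index j L by rewrite /r'; lia.
have r'n : (r' < n.-1)%N by rewrite /r'; lia.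
have rr' : (r < r')%N by rewrite /r'; lia.
have r'0 : (0 < r')%N by lia.
have := IH r' _ r'0 r'n; rewrite r'E nth_index // => H; have {}H := H ltac:(lia); move: H.
move=> /(Rinj _ _ _ (neP _ r0 rn) (neP _ r'0 r'n) Rj) /eqP.
by rewrite (negPf (ne _ _ rr' _)) //; lia.
Qed.

Let dvdE r r' : (0 < r)%N -> (r <= r')%N -> (r' < n)%N -> (E r %| E r')%N.
Proof.
move=> r0; elim: r' => [|r' IH]; first by rewrite leqn0 => /eqP ->.
rewrite leq_eqVlt => /orP[/eqP -> //|]; rewrite ltnS => rr' r'n.
have [||c c1 ->] := @chain r'; [by lia|by lia|].
by apply/dvdn_mull/IH => //; lia.
Qed.

(** Model variable [l >= 2] sits at rank [l - 1], since model variable [1] is the far vertex.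
    Dividing by the least positive position gives variable [2] the exponent [1], and [curve_dd n] is
    the degree. *)
Definition curve_dd l := (E l.-1 %/ E 1)%N.

Let ddK l : (1 < l)%N -> (l <= n)%N -> (E l.-1 = E 1 * curve_dd l)%N.
Proof. by move=> l1 ln; rewrite mulnC divnK // dvdE //; lia. Qed.

Let dd_ratio l : (1 < l)%N -> (l < n)%N ->
  exists2 c, (1 < c)%N & (curve_dd l.+1 = c * curve_dd l)%N.
Proof.
move=> l1 ln; have [||c c1 cE] := @chain l.-1; [by lia|by lia|].
have E1 : (0 < E 1)%N by rewrite E_gt0 //; lia.
exists c => //; apply/eqP; rewrite -(eqn_pmul2l E1) mulnCA.
by rewrite -(ddK (ltnW l1 : (1 < l.+1)%N) ln) -(ddK l1 (ltnW ln)) /= -cE (ltn_predK l1).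
Qed.

Let dd_gt1 l : (2 < l)%N -> (l <= n)%N -> (1 < curve_dd l)%N.
Proof.
elim: l => // l IH; rewrite ltnS => l1 ln; have [c c1 ->] := dd_ratio l1 ln.
have [e2|ne2] := eqVneq l 2; last by have := IH _ _; nia.
by rewrite e2 /curve_dd divnn E_gt0 //= ?muln1 //; lia.
Qed.

Lemma curve_shape : exists (s : {perm 'I_n}) d' dd,
  [/\ same_ker s a (@curveB n d' dd), (3 <= d')%N -> curve_cond n d' dd &
   (d' < 3)%N -> n = 3%N /\ exists2 q, uniq [:: P; Q; q] &
     imexp a (mX q 2) = imexp a (madd (mX P 1) (mX Q 1))].
Proof.
pose pos (l : 'I_n) := if val l == 0%N then 0%N else if val l == 1%N then n.-1 else l.-1.
have pos_lt l : (pos l < n)%N by rewrite /pos; have := ltn_ord l; do !case: ifP; lia.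
pose f l := nth P L (pos l).
have f_inj : injective f.
  move=> x y /eqP; rewrite nth_uniq ?sizeL // => /eqP H; apply: val_inj; move: H.
  rewrite /pos /=; have := ltn_ord x; have := ltn_ord y.
  by do !case: ifP; lia.
have ef l : e (f l) = E (pos l) by [].
have E1 : (0 < E 1)%N by rewrite E_gt0 //; lia.
have dE : d = (E 1 * curve_dd n)%N by rewrite -ddK ?Elast //; lia.
exists (perm f_inj), (curve_dd n), curve_dd; split.
- apply: (same_ker_scaled (c := E 1) (pi := fun j => if val j == 0%N then lP else lQ)) => //.
    by move=> j; case: (ord2 j) => ->; [exists ord0|exists ord_max].
  have H2 l : a (perm f_inj l) lQ = (E 1 * curveB (curve_dd n) curve_dd l ord_max)%N.
    rewrite permE -/(e _) ef /pos /curveB /=; case: eqP => ne0; first by rewrite E0 muln0.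
    case: eqP => ne1; first by rewrite Elast.
    case: eqP => [-> |ne2]; first by rewrite muln1.
    by rewrite ddK //; have := ltn_ord l; lia.
  move=> l j; case: ifP => j0; last first.
    by rewrite H2 /curveB j0 /=.
  have := aPE (perm f_inj l); rewrite /e H2 /curveB j0 /= => HH.
  by rewrite mulnBr -dE -[X in (X - _)%N]HH addnK.
- move=> d3; split=> //.
  move=> l /andP[l3 ln]; have [||c c1 cE] := @dd_ratio l; [by lia|by lia|].
  have g1 := @dd_gt1 l l3 (ltnW ln).
  have -> : (if (l.+1 < n)%N then curve_dd l.+1 else curve_dd n) = curve_dd l.+1.
    by case: ltnP => // ?; congr curve_dd; lia.
  by split; rewrite ?cE ?dvdn_mull //; nia.
(* For [n >= 4] the degree would be [c * curve_dd n.-1], at least [4] as both factors exceed [1]. *)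
move=> d3; have n3' : n = 3%N.
  apply/eqP; rewrite eqn_leq n3 andbT leqNgt; apply/negP => n4.
  have [||c c1 cE] := @dd_ratio n.-1; [by lia|by lia|].
  have := @dd_gt1 n.-1; move: d3; rewrite -[X in curve_dd X](prednK (ltac:(lia) : (0 < n)%N)) cE.
  by nia.
split=> //; exists (nth P L 1).
  have -> : [:: P; Q; nth P L 1] = [seq nth P L x | x <- [:: 0; n.-1; 1]%N].
    by rewrite /= nth0 nth_last.
  rewrite map_inj_in_uniq; first by rewrite n3'.
  have mem3 z : z \in [:: 0; n.-1; 1]%N -> (z < size L)%N.
    by rewrite sizeL n3' !inE => /or3P[] /eqP ->.
  by move=> x y /mem3 xL /mem3 yL /eqP; rewrite nth_uniq // => /eqP.
have [||c c1 cE] := @dd_ratio 2; [by lia|by lia|].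
(* The degree [curve_dd 3], below [3], equals the ratio [c > 1], so [c = 2] and the middle variable
   is the midpoint of [P] and [Q]. *)
have d2 : d = (2 * E 1)%N.
  have dd2 : curve_dd 2 = 1%N by rewrite /curve_dd divnn E1.
  by move: d3; rewrite dE (congr1 curve_dd n3') cE dd2; nia.
have := aPE P; have := aPE Q; have := aPE (nth P L 1); rewrite eP0 eQd -/(E 1) => h1 h2 h3.
apply/ffunP => l; rewrite imexp_madd imexp_mX ffunE !imexp_mX; case: (ord2 l) => ->; first by lia.
by rewrite -/(e P) -/(e Q) -/(e (nth P L 1)) eP0 eQd -/(E 1); lia.
Qed.

End CaseCurve.

(** * From the variety back to its degree map *)

(** [X^p - X^q], if nonzero, has a non-root over an algebraically closed field. *)
Lemma exp_inj (k : closedFieldType) p q : (forall t : k, t ^+ p = t ^+ q) -> p = q.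
Proof.
move=> H; apply/eqP; apply: contraT => ne.
have nz : 'X^p - 'X^q != 0 :> {poly k}.
  rewrite subr_eq0; apply: contraNneq ne => /(congr1 (fun f : {poly k} => size f)).
  by rewrite !size_polyXn => -[] ->.
have /closed_nonrootP[t] := nz.
by rewrite /root !hornerE H subrr eqxx.
Qed.

Lemma mev_one_parameter (k : fieldType) m n (b : 'I_n -> 'I_m -> nat) (t : k) j al :
  mev (fun l => t ^+ b l j) al = t ^+ imexp b al j.
Proof.
rewrite ffunE /mev -prodrXr; apply: eq_bigr => i _.
by rewrite -exprM mulnC.
Qed.

(** This point is the image of the parameter vector with [t] at place [j] and [1] elsewhere. *)
Lemma one_parameter_inV (k : fieldType) m n (b : 'I_n -> 'I_m -> nat) (t : k) j :
  inV b (fun l => t ^+ b l j).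
Proof.
move=> f fI; rewrite pevalE (inIA_psum fI) // => al be e.
by rewrite !mev_one_parameter e.
Qed.

(** A binomial in one ideal vanishes on the one-parameter points of the other variety; for all [t]
    this equates two powers of [t], so the degrees agree coordinate by coordinate. *)
Lemma same_ker_of_inV (k : closedFieldType) m m' n
    (a : 'I_n -> 'I_m -> nat) (b : 'I_n -> 'I_m' -> nat) :
  same_up_to_perm k a b -> exists s : {perm 'I_n}, same_ker s a b.
Proof.
move=> [s H]; exists s => al be; split=> e; apply/ffunP => j; apply: (@exp_inj k) => t.
  rewrite -!mev_one_parameter; set y := (fun l => _).
  have yE : y = (fun l => y ((s^-1)%g (s l))) by apply/funext => l; rewrite permK.
  have /(_ _ (inIA_bin k e)) : inV a (fun x => y ((s^-1)%g x)).
    by apply/H; rewrite -yE; apply: one_parameter_inV.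
  rewrite pevalE psum_bin -!(mev_perm s (fun x => y ((s^-1)%g x))) -yE.
  by move=> /eqP; rewrite subr_eq0 => /eqP.
rewrite -!mev_one_parameter; set y := (fun l => _).
have /H/(_ _ (inIA_bin k e)) : inV a y by apply: one_parameter_inV.
by rewrite pevalE psum_bin !(mev_perm s y) => /eqP; rewrite subr_eq0 => /eqP.
Qed.

Lemma same_ker_sym m m' n (a : 'I_n -> 'I_m -> nat) (b : 'I_n -> 'I_m' -> nat)
    (s : {perm 'I_n}) : same_ker s a b -> same_ker (s^-1)%g b a.
Proof. by move=> sk al be; split=> e; [apply/sk|move/sk: e]; rewrite !mpermK. Qed.

(** Without parameters no exponent vector is nonzero; with a single one all of them equal [d], yet
    there are at least two distinct ones. *)
Lemma simplicial_ge2 m n d (a : 'I_n -> 'I_m -> nat) : simplicial_data d a -> (2 <= m)%N.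
Proof.
move=> S; have lt := simplicial_lt S.
case: m a S lt => [|[|m]] // a S lt.
  by case: S => _ _ /(_ (Ordinal lt)) [[]].
have n0 : (0 < n)%N by exact: ltn_trans lt.
suff /(congr1 val) : Ordinal n0 = Ordinal lt by [].
apply: (simplicial_inj S) => l.
have E i : a i l = d by rewrite -(simplicial_sum S i) big_ord1 (ord1 l).
by rewrite !E.
Qed.


Lemma vertices_independent m n d (a : 'I_n -> 'I_m -> nat) (S : simplicial_data d a)
    (al be : mono n) : (forall i : 'I_n, (m <= i)%N -> al i = be i) ->
  imexp a al = imexp a be -> al = be.
Proof.
move=> H e; apply/ffunP => i; case: (ltnP i m) => [im|/H //].
have E w : imexp a w (Ordinal im) =
    (w i * d + \sum_(j : 'I_n | (m <= j)%N) w j * a j (Ordinal im))%N.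
  rewrite ffunE (bigID (fun j : 'I_n => (m <= j)%N)) /= addnC; congr (_ + _)%N.
  rewrite (bigD1 i) -?ltnNge //= big1 ?addn0 => [|j /andP[]].
    by rewrite (simplicial_vertex S) //= eqxx.
  rewrite -ltnNge => jm ne; rewrite (simplicial_vertex S) //=.
  by case: eqP => [e'|]; rewrite ?muln0 //; case/eqP: ne; apply: val_inj.
have /ffunP/(_ (Ordinal im)) := e; rewrite !E.
rewrite [in RHS](eq_bigr (fun j => al j * a j (Ordinal im))%N) => [|j mj]; last by rewrite H.
by move=> /addIn/eqP; rewrite eqn_pmul2r ?(simplicial_gt0 S) // => /eqP.
Qed.

Lemma three_dependent_sorted n d (b : 'I_n -> 'I_2 -> nat) (S : simplicial_data d b)
    (x y z : 'I_n) : (b x ord_max < b y ord_max)%N -> (b y ord_max < b z ord_max)%N ->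
  exists al be : mono n, [/\ al <> be, imexp b al = imexp b be &
    forall i, i \notin [:: x; y; z] -> al i = be i].
Proof.
set e := fun i => b i ord_max; rewrite -!/(e _) => xy yz.
have bE i : b i ord0 = (d - e i)%N.
  rewrite -(simplicial_sum S i) big_ord_recr big_ord1 /e /=.
  have -> : widen_ord (leqnSn 1) ord0 = ord0 :> 'I_2 by apply: val_inj.
  by rewrite addnK.
have ed i : (e i <= d)%N by rewrite -(simplicial_sum S i) big_ord_recr leq_addl.
(* Collinear exponent vectors: the middle one is a weighted mean of the outer two, each weighted by
   the gap on the opposite side. *)
exists (madd (mX x (e z - e y)) (mX z (e y - e x))), (mX y (e z - e x)); split.
- move=> /ffunP/(_ y); rewrite !ffunE eqxx.
  have -> : (y == x) = false by apply/eqP => E; rewrite E ltnn in xy.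
  have -> : (y == z) = false by apply/eqP => E; rewrite E ltnn in yz.
  lia.
- have main : ((e z - e y) * e x + (e y - e x) * e z = (e z - e x) * e y)%N by nia.
  apply/ffunP => j; rewrite imexp_madd ffunE !imexp_mX.
  have [->|->] : j = ord_max \/ j = ord0.
  + by case: j => [[|[|j]] // jP]; [right|left]; apply: val_inj.
  + exact: main.
  by rewrite !bE; have := ed x; have := ed y; have := ed z; nia.
move=> i; rewrite !inE !negb_or => /and3P[ix iy iz].
by rewrite !ffunE (negPf ix) (negPf iy) (negPf iz).
Qed.

Lemma three_dependent n d (b : 'I_n -> 'I_2 -> nat) (S : simplicial_data d b)
    (x y z : 'I_n) : uniq [:: x; y; z] ->
  exists al be : mono n, [/\ al <> be, imexp b al = imexp b be &
    forall i, i \notin [:: x; y; z] -> al i = be i].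
Proof.
have inj i i' : b i ord_max = b i' ord_max -> i = i'.
  move=> E; apply: (simplicial_inj S) => j.
  have := simplicial_sum S i; rewrite -(simplicial_sum S i') !big_ord_recr !big_ord0 /= !add0n.
  rewrite E => /addIn; have [->|->] : j = ord_max \/ j = ord0.
  - by case: j => [[|[|j]] // jP]; [right|left]; apply: val_inj.
  - by [].
  by have -> : widen_ord (leqnSn 1) ord_max = ord0 :> 'I_2 by apply: val_inj.
have lt i i' : i != i' -> (b i ord_max < b i' ord_max)%N || (b i' ord_max < b i ord_max)%N.
  by move=> ne; rewrite -neq_ltn; apply: contraNneq ne => /inj ->.
have perm x' y' z' : [:: x; y; z] =i [:: x'; y'; z'] ->
   (b x' ord_max < b y' ord_max)%N -> (b y' ord_max < b z' ord_max)%N ->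
  exists al be : mono n, [/\ al <> be, imexp b al = imexp b be &
    forall i, i \notin [:: x; y; z] -> al i = be i].
  move=> E xy yz; have [al [be [ne e H]]] := three_dependent_sorted S xy yz.
  by exists al, be; split=> // i; rewrite E; apply: H.
rewrite /= !inE negb_or andbT => /andP[/andP[/lt xy /lt xz] /lt yz].
case/orP: xy => xy; case/orP: yz => yz; case/orP: xz => xz; try lia.
- by apply: (perm x y z).
- by apply: (perm x z y) => // i; rewrite !inE; do !case: eqP.
- by apply: (perm z x y) => // i; rewrite !inE; do !case: eqP.
- by apply: (perm y x z) => // i; rewrite !inE; do !case: eqP.
- by apply: (perm y z x) => // i; rewrite !inE; do !case: eqP.
- by apply: (perm z y x) => // i; rewrite !inE; do !case: eqP.
Qed.

(** The vertex variables of [a] satisfy no relation among themselves, while any three variables of a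
    two-parameter model do. *)
Lemma same_ker_dim m n d d' (a : 'I_n -> 'I_m -> nat) (b : 'I_n -> 'I_2 -> nat)
    (s : {perm 'I_n}) : simplicial_data d a -> simplicial_data d' b ->
  same_ker s a b -> (m <= 2)%N.
Proof.
move=> S S' sk; rewrite leqNgt; apply/negP => m3.
pose x l (lm : (l < m)%N) : 'I_n := (s^-1)%g (vx S (Ordinal lm)).
have m1 : (0 < m)%N by lia. have m2 : (1 < m)%N by lia.
have [|al [be [ne e H]]] := @three_dependent _ _ _ S' (x _ m1) (x _ m2) (x _ m3).
  by rewrite /= !inE !(inj_eq (@perm_inj _ _)).
apply: ne; apply: (@mperm_inj _ (s^-1)%g).
apply: (vertices_independent S); last by apply/sk; rewrite !mpermK.
move=> i mi; rewrite !ffunE; apply: H.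
rewrite !inE !(inj_eq (@perm_inj _ _)) !negb_or.
by apply/and3P; split; apply: contraTneq mi => ->; rewrite -ltnNge.
Qed.

(** Each relation rewrites [x_(v l)^(c l)] to [M l], which lowers the weight [wt], so rewriting
    stops at a monomial whose exponents at the [v l] are below [c l]. Such normal forms being
    determined by their degree, any binomial of the ideal reduces to zero. *)
Lemma pure_power_generators (k : fieldType) m n r (a : 'I_n -> 'I_m -> nat)
    (v : 'I_r -> 'I_n) (c : 'I_r -> nat) (M : 'I_r -> mono n) (wt : 'I_n -> nat) :
  (forall l, imexp a (M l) = imexp a (mX (v l) (c l))) ->
  (forall l, \sum_x M l x * wt x < c l * wt (v l))%N ->
  (forall al be : mono n, imexp a al = imexp a be ->
     (forall l, al (v l) < c l)%N -> (forall l, be (v l) < c l)%N -> al = be) ->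
  exists g : 'I_r -> mpol k n, forall f, inIA a f <-> inG g f.
Proof.
move=> eM ltM uniqM; pose g l := bin k (mX (v l) (c l)) (M l).
have gI l : inIA a (g l) by apply/inIA_bin/esym/eM.
pose W (al : mono n) := (\sum_x al x * wt x)%N.
have WD al be : W (madd al be) = (W al + W be)%N.
  by rewrite /W -big_split; apply: eq_bigr => x _; rewrite ffunE mulnDl.
have WX x N : W (mX x N) = (N * wt x)%N.
  rewrite /W (bigD1 x) //= big1 ?addn0 ?ffunE ?eqxx // => y /negPf ne.
  by rewrite ffunE ne.
have red al : exists be, [/\ inG g (bin k al be), imexp a al = imexp a be &
    forall l, (be (v l) < c l)%N].
  have [N] := ubnP (W al); elim: N al => // N IH al lt.
  have [/existsP[l cl]|/existsPn H] := boolP [exists l, (c l <= al (v l))%N]; last first.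
    by exists al; split=> // [|l]; [exact: inG_bin_refl|rewrite ltnNge].
  have alE : al = madd (mX (v l) (c l)) (msub al (mX (v l) (c l))).
    by rewrite msubK // => x; rewrite ffunE; case: eqP => // ->.
  pose ga := msub al (mX (v l) (c l)).
  have step : inG g (bin k al (madd (M l) ga)).
    apply: inG_peq (inG_shift g l ga) => C.
    by rewrite psum_pmul big_seq1 mul1r /= !psum_bin {1}alE -/ga ![madd ga _]maddC.
  have [|be [G e H]] := IH (madd (M l) ga).
    move: lt; rewrite {1}alE !WD WX -/ga ltnS => lt; apply: leq_trans lt.
    by rewrite ltn_add2r; apply: ltM.
  exists be; split=> //; first exact: inG_bin_trans step G.
  by rewrite -e alE -/ga !imexp_madd eM.
exists g; apply: toric_generated => // al be e.
have [al' [G1 e1 H1]] := red al; have [be' [G2 e2 H2]] := red be.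
have E : al' = be' by apply: uniqM; rewrite -?e1 ?e.
by apply: inG_bin_trans G1 _; apply: inG_bin_sym; rewrite E.
Qed.

Lemma pure_power_generators_perm (k : fieldType) m m' n r (a : 'I_n -> 'I_m -> nat)
    (b : 'I_n -> 'I_m' -> nat) (s : {perm 'I_n})
    (v : 'I_r -> 'I_n) (c : 'I_r -> nat) (M : 'I_r -> mono n) (wt : 'I_n -> nat) :
  same_ker s a b ->
  (forall l, imexp b (M l) = imexp b (mX (v l) (c l))) ->
  (forall l, \sum_x M l x * wt x < c l * wt (v l))%N ->
  (forall al be : mono n, imexp b al = imexp b be ->
     (forall l, al (v l) < c l)%N -> (forall l, be (v l) < c l)%N -> al = be) ->
  exists g : 'I_r -> mpol k n, forall f, inIA a f <-> inG g f.
Proof.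
move=> sk eM ltM uniqM.
apply: (@pure_power_generators _ _ _ _ _ (fun l => s (v l)) c
  (fun l => mperm (s^-1)%g (M l)) (fun x => wt (s^-1 x)%g)).
- move=> l; apply/sk; rewrite mpermK eM; congr imexp.
  by apply/ffunP => x; rewrite !ffunE (inj_eq (@perm_inj _ s)).
- move=> l; rewrite permK (reindex_inj (@perm_inj _ s)) /=.
  by under eq_bigr do rewrite ffunE permK; exact: ltM.
move=> al be /sk e H1 H2; apply: (@mperm_inj _ s); apply: uniqM => // l; rewrite ffunE //.
Qed.

(** * The two models *)

Section CurveModel.
Local Open Scope nat_scope.
Variables (n d : nat) (dd : nat -> nat).
Hypothesis cc : curve_cond n d dd.

(* The second exponents of the variables other than the two vertices, in
   increasing order, followed by that of the vertex [t_2^d]. *)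
Definition cexp p := if p == 2%N then 1%N else if (p < n)%N then dd p else d.

Lemma cexp_step p : (2 <= p)%N -> (p < n)%N ->
  (cexp p < cexp p.+1)%N /\ (cexp p %| cexp p.+1)%N.
Proof.
case: cc => n3 d3 H p2 pn; rewrite /cexp pn eqSS.
have -> : (p == 1%N) = false by apply/eqP; lia.
case: eqP => [p2'|/eqP p2'].
  rewrite p2'; split; last exact: dvd1n.
  case: (ltnP 3 n) => [n4|_]; last exact: ltnW.
  by have [] := H 3; [rewrite /= n4|].
have p3 : (2 < p)%N by lia.
by have [] := H p; [rewrite p3 pn|].
Qed.

Lemma cexp_lt p q : (2 <= p)%N -> (p < q)%N -> (q <= n)%N -> (cexp p < cexp q)%N.
Proof.
move=> p2; elim: q => // q IH; rewrite ltnS leq_eqVlt => /orP[/eqP <-|pq] qn.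
  by have [] := cexp_step p2 qn.
have [lt _] := cexp_step (leq_trans p2 (ltnW pq)) qn.
exact: ltn_trans (IH pq (ltnW qn)) lt.
Qed.

Lemma cexp_dvd p q : (2 <= p)%N -> (p <= q)%N -> (q <= n)%N -> (cexp p %| cexp q)%N.
Proof.
move=> p2; elim: q => [|q IH]; first by rewrite leqn0 => /eqP <-.
rewrite leq_eqVlt => /orP[/eqP <- //|]; rewrite ltnS => pq qn.
have [_] := cexp_step (leq_trans p2 pq) qn.
exact/dvdn_trans/IH/ltnW.
Qed.

Lemma cexp_n : cexp n = d.
Proof. by rewrite /cexp ltnn; case: cc => n3 _ _; case: eqP => [?|//]; lia. Qed.

Lemma cexp_gt0 p : (2 <= p)%N -> (p <= n)%N -> (0 < cexp p)%N.
Proof.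
rewrite leq_eqVlt => /orP[/eqP <- //|p2] pn.
exact: leq_trans (cexp_lt (leqnn 2) p2 pn).
Qed.

Definition cpos i := if i == 0%N then 0%N else if i == 1%N then d else cexp i.

Lemma cpos_le (i : 'I_n) : (cpos i <= d)%N.
Proof.
rewrite /cpos; case: eqP => // i0; case: eqP => // i1.
by rewrite -cexp_n ltnW // cexp_lt //; lia.
Qed.

Lemma curveB1 (i : 'I_n) : curveB d dd i ord_max = cpos i.
Proof. by rewrite /curveB /cpos /cexp /= ltn_ord. Qed.

Lemma curveB0 (i : 'I_n) : curveB d dd i ord0 = (d - cpos i)%N.
Proof. by rewrite /curveB /cpos /cexp /= ltn_ord. Qed.

Lemma ord2E (j : 'I_2) : j = ord0 \/ j = ord_max.
Proof. by case: j => [[|[|j]] // jP]; [left|right]; apply: val_inj. Qed.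

Lemma cpos_inj (i j : 'I_n) : cpos i = cpos j -> i = j.
Proof.
case: cc => n3 d3 _.
have key x y : (x < y)%N -> (y < n)%N -> cpos x <> cpos y.
  move=> xy yn; rewrite /cpos.
  have -> : (y == 0%N) = false by apply/eqP; lia.
  have [x0|x0] := eqVneq x 0%N.
    case: (eqVneq y 1%N) => y1; first by lia.
    by have := @cexp_gt0 y _ (ltnW yn); lia.
  have -> : (y == 1%N) = false by apply/eqP; lia.
  have [x1|x1] := eqVneq x 1%N.
    by have := @cexp_lt y n _ yn (leqnn n); rewrite cexp_n; lia.
  by have := @cexp_lt x y _ xy (ltnW yn); lia.
move=> e; apply: val_inj => /=; case: (ltngtP i j) => // xy.
  by case: (key _ _ xy (ltn_ord j)).
by case: (key _ _ xy (ltn_ord i)).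
Qed.

Lemma curveB_simplicial : simplicial_data d (@curveB n d dd).
Proof.
case: (cc) => n3 d3 _; split.
- by split; lia.
- by move=> x y /(congr1 (@^~ ord_max)); rewrite !curveB1 => /cpos_inj.
- move=> i; have [c0|c0] := eqVneq (cpos (val i)) 0%N.
    by exists ord0; rewrite curveB0 c0; lia.
  by exists ord_max; rewrite curveB1; apply/eqP.
- move=> i j i2; case: (ord2E j) => ->; rewrite ?curveB0 ?curveB1 /cpos.
    by case: i i2 => [[|[|i]] iP] //= _; rewrite ?subn0 ?subnn.
  by case: i i2 => [[|[|i]] iP] //= _.
move=> i _; rewrite big_ord_recr big_ord1 /=.
have -> : widen_ord (leqnSn 1) ord0 = ord0 :> 'I_2 by apply: val_inj.
by rewrite curveB0 curveB1 subnK // cpos_le.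
Qed.

Lemma curve_imexp (al be : mono n) :
  imexp (curveB d dd) al ord_max = imexp (curveB d dd) be ord_max ->
  tdeg al = tdeg be -> imexp (@curveB n d dd) al = imexp (curveB d dd) be.
Proof.
move=> e t; apply/ffunP => j.
have := imexp_sum curveB_simplicial al; rewrite t -(imexp_sum curveB_simplicial be).
rewrite !big_ord_recr !big_ord0 /= !add0n e => /addIn.
have -> : widen_ord (leqnSn 1) ord_max = ord0 :> 'I_2 by apply: val_inj.
by case: (ord2E j) => ->.
Qed.

Let vpos (l : 'I_(n - 2)) : (l + 2 < n)%N.
Proof. by have := ltn_ord l; lia. Qed.

Let n0 : (0 < n)%N. Proof. by case: cc => ? _ _; lia. Qed.
Let n1 : (1 < n)%N. Proof. by case: cc => ? _ _; lia. Qed.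

Let v l : 'I_n := Ordinal (vpos l).
Let c (l : 'I_(n - 2)) := (cexp (l + 3) %/ cexp (l + 2))%N.
(** For the last [l], [l + 3 = n] is out of range and the next variable is the vertex at position
    [d], which is [cexp n]. *)
Let nxt (l : 'I_(n - 2)) : 'I_n := if insub (l + 3)%N is Some x then x else Ordinal n1.

Let nxt_cpos l : cpos (nxt l) = cexp (l + 3).
Proof.
rewrite /nxt; have := vpos l; case: insubP => [x _ ex _|].
  by rewrite -[nat_of_ord x]/(val x) ex addn3.
rewrite -leqNgt /cpos /= => ge lt; have -> : (l + 3 = n)%N by lia.
by rewrite cexp_n.
Qed.

Let nxt0 l : val (nxt l) != 0%N.
Proof. by rewrite /nxt; case: insubP => [x _ ->|//]; rewrite addn3. Qed.

Let cE l : (c l * cexp (l + 2) = cexp (l + 3))%N.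
Proof. by rewrite divnK // cexp_dvd //; have := vpos l; lia. Qed.

Let c_gt1 l : (1 < c l)%N.
Proof.
have := @cexp_lt (l + 2) (l + 3); rewrite -cE; have := vpos l.
by move=> ? H; have := H ltac:(lia) ltac:(lia) ltac:(lia); nia.
Qed.

(** The relations are [x_v^c = x_nxt x_0^(c-1)], where [c] is the ratio of consecutive positions.
    The weight counts all variables except [x_0], so it drops from [c] to [1]. *)
Lemma curve_generators (k : fieldType) m (a : 'I_n -> 'I_m -> nat) (s : {perm 'I_n}) :
  same_ker s a (@curveB n d dd) ->
  exists g : 'I_(n - 2) -> mpol k n, forall f, inIA a f <-> inG g f.
Proof.
move=> sk; apply: (pure_power_generators_perm (v := v) (c := c)
  (M := fun l => madd (mX (nxt l) 1) (mX (Ordinal n0) (c l).-1))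
  (wt := fun x => (val x != 0)%N) k sk).
- move=> l; apply: curve_imexp.
    rewrite imexp_madd ffunE !imexp_mX !curveB1 nxt_cpos.
    have -> : cpos (v l) = cexp (l + 2) by rewrite /cpos /= addn2.
    by rewrite cE /cpos /= muln0 addn0 mul1n.
  by rewrite tdeg_madd !tdeg_mX add1n prednK // ltnW // c_gt1.
- move=> l; rewrite (bigD1 (nxt l)) //= big1 ?addn0.
    rewrite !ffunE eqxx -[nxt l == _](inj_eq val_inj) (negPf (nxt0 l)) addn0.
    by rewrite addn2 /= !muln1 c_gt1.
  move=> x ne; rewrite !ffunE (negPf ne); case: eqP => [->|_] //=.
  by rewrite muln0.
move=> al be e Hal Hbe.
have E (w : mono n) : imexp (curveB d dd) w ord_max = \sum_x w x * cpos x.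
  by rewrite ffunE; apply: eq_bigr => x _; rewrite curveB1.
have e1 : \sum_x al x * cpos x = \sum_x be x * cpos x by rewrite -!E e.
have et := simplicial_tdeg curveB_simplicial e.
(* Mixed-radix uniqueness: modulo [cexp x.+1] only the digits up to [x] survive. *)
have key p : forall x : 'I_n, x < p -> 1 < x -> al x = be x.
  elim: p => // p IH x; rewrite ltnS leq_eqVlt => /orP[/eqP xp|]; last exact: IH.
  move=> x2; have xl : x - 2 < n - 2 by have := ltn_ord x; lia.
  have vx : v (Ordinal xl) = x by apply: val_inj => /=; lia.
  have cx : 0 < cexp x by rewrite cexp_gt0 // ltnW.
  have lim w : w < c (Ordinal xl) -> w * cexp x < cexp x.+1.
    move=> H; have := cE (Ordinal xl) => /=.
    have -> : x - 2 + 2 = x by lia. have -> : x - 2 + 3 = x.+1 by lia.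
    by move=> <-; rewrite ltn_pmul2r.
  (* The remaining variables are the two vertices and those beyond [x]; by the divisibility chain
     all their positions are multiples of [cexp x.+1]. *)
  have tail (w : mono n) : cexp x.+1 %| \sum_(y < n | ~~ (1 < y < x) && (y != x)) w y * cpos y.
    apply: dvdn_sum => y /andP[yx ynx]; apply: dvdn_mull.
    have yx' : nat_of_ord y <> x by move=> eyx; case/eqP: ynx; apply: val_inj.
    rewrite /cpos; case: eqP => y0; first exact: dvdn0.
    by case: eqP => y1; rewrite -?cexp_n cexp_dvd //; have := ltn_ord y; lia.
  have split (w : mono n) : \sum_y w y * cpos y =
      \sum_(y < n | 1 < y < x) w y * cpos y +
      (w x * cexp x + \sum_(y < n | ~~ (1 < y < x) && (y != x)) w y * cpos y).
    rewrite (bigID (fun y : 'I_n => 1 < y < x)) /=; congr (_ + _).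
    rewrite (bigD1 x) /=; last by rewrite ltnn andbF.
    congr (_ * _ + _); rewrite /cpos; do 2![case: eqP => [?|_]; first lia].
    by [].
  move: e1; rewrite !split.
  rewrite [X in X + _ = _](eq_bigr (fun y => be y * cpos y)); last first.
    by move=> y /andP[y1 yx]; rewrite IH // -xp.
  move=> /addnI; have /dvdnP[q1 ->] := tail al; have /dvdnP[q2 ->] := tail be.
  move=> /(congr1 (modn^~ (cexp x.+1))); rewrite ![_ * cexp x + _]addnC !modnMDl.
  rewrite !modn_small; first by move=> /eqP; rewrite eqn_pmul2r // => /eqP.
  - by apply: lim; rewrite -{1}vx.
  - by apply: lim; rewrite -{1}vx.
have key2 (x : 'I_n) : 1 < x -> al x = be x by exact: (key n).
have d0 : 0 < d := simplicial_gt0 curveB_simplicial.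
(* Only the vertices remain: the sum of positions fixes the exponent of [z1], then the total degree
   fixes that of [z0]. *)
pose z0 := Ordinal n0; pose z1 := Ordinal n1.
have H1 : al z1 = be z1.
  move: e1; rewrite (bigD1 z1) // [RHS](bigD1 z1) //=.
  rewrite [X in _ + X = _](eq_bigr (fun y => be y * cpos y)); last first.
    move=> y y1; case: (posnP y) => [y0|y0]; first by rewrite /cpos y0 !muln0.
    rewrite key2 // ltn_neqAle y0 andbT; apply: contraNneq y1 => y1.
    by apply/eqP/val_inj.
  by move=> /addIn/eqP; rewrite eqn_pmul2r // => /eqP.
have H0 : al z0 = be z0.
  move: et; rewrite /tdeg (bigD1 z0) // [RHS](bigD1 z0) //=.
  rewrite [X in _ + X = _](eq_bigr be); first by move=> /addIn.
  move=> y y0; have [y1|y1] := eqVneq y z1; first by rewrite y1.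
  apply: key2; move: y0 y1; rewrite -!val_eqE /=; lia.
apply/ffunP => y; have [->//|y0] := eqVneq y z0; have [->//|y1] := eqVneq y z1.
by apply: key2; move: y0 y1; rewrite -!val_eqE /=; lia.
Qed.

End CurveModel.

Definition o31 : 'I_3 := Ordinal (isT : (1 < 3)%N).
Definition o32 : 'I_3 := Ordinal (isT : (2 < 3)%N).

Lemma surfB_simplicial : simplicial_data 2 (@surfB 4).
Proof.
split=> //.
- move=> x y e; apply: val_inj.
  have := congr1 (fun f => [:: f ord0; f o31; f o32]) e.
  rewrite /surfB /=.
  by case: x y {e} => [[|[|[|[|x]]]] // xP] [[|[|[|[|y]]]] // yP].
- move=> i; rewrite /surfB.
  case: i => [[|[|[|[|i]]]] // iP]; [exists ord0|exists o31|exists o32|exists ord0];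
    by [].
- by move=> i j; rewrite /surfB => ->.
move=> i i3; rewrite !big_ord_recr big_ord0 /surfB /=.
by rewrite ltnNge i3.
Qed.

(** The relation is [x_3^2 = x_0 x_1], weighted by the exponent of [x_3]. In a normal form that
    exponent is [0] or [1], hence read off from the parity of the first coordinate of the degree. *)
Lemma surface_generators (k : fieldType) m (a : 'I_4 -> 'I_m -> nat) (s : {perm 'I_4}) :
  same_ker s a (@surfB 4) ->
  exists g : 'I_(4 - 3) -> mpol k 4, forall f, inIA a f <-> inG g f.
Proof.
move=> sk; pose x0 : 'I_4 := ord0; pose x1 : 'I_4 := Ordinal (isT : (1 < 4)%N).
apply: (pure_power_generators_perm (v := fun=> ord_max) (c := fun=> 2%N)
  (M := fun l => madd (mX x0 1) (mX x1 1))
  (wt := fun x => (val x == 3)%N) k sk).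
- move=> l; apply/ffunP => j; rewrite imexp_madd [LHS]ffunE !imexp_mX /surfB /x0 /x1 /=.
  by case: j => [[|[|[|j]]] // jP].
- move=> l; rewrite big1 => [|x _]; first exact: isT.
  rewrite !ffunE -!val_eqE /=.
  by case: x => [[|[|[|[|x]]]] // xP].
move=> al be /ffunP e /(_ ord0) H1 /(_ ord0) H2.
have E (w : mono 4) j : imexp (@surfB 4) w j = (\sum_(i < 4) w i * surfB i j)%N by rewrite ffunE.
have := e ord0; have := e o31; have := e o32.
rewrite !E !big_ord_recr !big_ord0 /surfB /= !muln0 !add0n !addn0 !muln1.
move=> h2 h1 h0; apply/ffunP => x.
set y0 : 'I_4 := widen_ord _ (widen_ord _ _) in h1.
set y1 : 'I_4 := widen_ord _ (widen_ord _ _) in h0.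
set y2 : 'I_4 := widen_ord _ _ in h2.
have [->|->|->|->] : [\/ x = y0, x = y1, x = y2 | x = ord_max].
  by case: x => [[|[|[|[|x]]]] // xP];
    [constructor 2|constructor 1|constructor 3|constructor 4]; apply: val_inj.
all: by move: H1 H2 => /=; lia.
Qed.

(* Both directions of the classification *)
Local Close Scope ring_scope.

Theorem mainTheorem14 (k : closedFieldType) (m n d : nat) (a : 'I_n -> 'I_m -> nat) :
  simplicial_data d a ->
  @one_singular_point k m n a ->
  (ideal_ci k a <->
    ((exists (d' : nat) (dd : nat -> nat),
        curve_cond n d' dd /\ same_up_to_perm k a (@curveB n d' dd))
     \/ (n = 4 /\ same_up_to_perm k a (@surfB n)))).
Proof.
move=> S one; have m2 := simplicial_ge2 S; split=> [ci|].
  have [m3|m3] := leqP 3 m.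
    right; have [mE nE [l1 [l2 [ne12 H]]]] := surface_shape S one ci m3.
    subst m n; split=> //; apply: (surface_case k (S := S) ne12) => j.
    exact: H.
  left; have mE : m = 2 by lia.
  subst m; have [g gen] := ci.
  have [i0 smooth] := exceptional_vertex S one (isT : (0 < 2)%N).
  have [lP ne] : exists lP, lP != i0.
    exists (if i0 == ord0 then ord_max else ord0).
    by case: (eqVneq i0 ord0) => [->|] //; rewrite eq_sym.
  have [s [d' [dd [sk cc conic]]]] := curve_shape gen ne (smooth lP ne).
  have [d3|d3] := leqP 3 d'.
    by exists d', dd; split; [exact: cc | exact: same_ker_inV sk].
  (* Degree below [3] leaves only the conic, which has no singular point. *)
  have [nE [q uq e]] := conic d3; have [p [sp _]] := one.
  by subst n; case: (conic_smooth S uq e sp).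
case=> [[d' [dd [cc /same_ker_of_inV[s sk]]]]|[nE /same_ker_of_inV[s sk]]].
  have mE : m = 2.
    by apply/eqP; rewrite eqn_leq m2 (same_ker_dim S (curveB_simplicial cc) sk).
  by subst m; apply: (curve_generators cc k sk).
(* If [m] were [2], the three independent vertices of the surface model would be carried to a
   two-parameter configuration. *)
subst n; have mE : m = 3.
  have := simplicial_lt S; rewrite ltnS => m3.
  apply/eqP; rewrite eqn_leq m3 ltn_neqAle m2 andbT; apply/negP => /eqP mE.
  by subst m; have := same_ker_dim surfB_simplicial S (same_ker_sym sk).
by subst m; apply: (surface_generators k sk).
Qed.
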